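(* Let $\{\psi_{\mathcal A}\}_{\mathcal A\in\mathrm{CA}}$ be a collection with $\psi_{\mathcal A}\in\mathfrak Z^2[\mathbf A_1]$, and let $\Omega^{\cdot}$ be the category associated to the factorizable collection $\omega_{\mathcal A,\mathcal B}=\mathfrak j(\psi_{\mathcal B}^{!},\psi_{\mathcal A},\mathbb I^{\otimes 2})$, regarded as a semigroupoid (a sub-semigroupoid of $\mathfrak H\mathrm{CA}^\circ$) with partial product $\circ_\Omega$. Then the embedding functor $\mathfrak P^{\Omega}:\Omega^{\cdot}\hookrightarrow\mathrm{CA}$, $\langle\varphi,\mathcal H\rangle\mapsto\mathcal H$, $\alpha\mapsto\alpha$, preserves the respective (partial) products and units, i.e. $$\mathfrak P^{\Omega}\,\circ_{\Omega}=\circ\,(\mathfrak P^{\Omega}\times\mathfrak P^{\Omega})\qquad\text{and}\qquad \mathfrak P^{\Omega}\langle\ell_{\mathcal A},\mathcal K\rangle=\mathcal K\quad\text{for all }\mathcal A\in\mathrm{CA},$$ the first equality being on the domain of $\circ_\Omega$.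
   Context: Conic quantum spaces. Fix a field $\Bbbk$. For a vector space $V$, $V^{\otimes}=\bigoplus_{r\ge0}V^{\otimes r}$ is its tensor algebra. A conic quantum space $\mathcal A=(\mathbf A_1,\mathbf A)$ is a finite-dimensional vector space $\mathbf A_1$ together with a graded algebra $\mathbf A=\bigoplus_n\mathbf A_n=\mathbf A_1^{\otimes}/\mathbf I$, where $\mathbf I=\bigoplus_{n\ge2}\mathbf I_n$ is a graded two-sided ideal. $\mathrm{CA}$ is the category of conic quantum spaces, with morphisms the unital algebra maps sending generators $\mathbf A_1$ into generators. It is monoidal with $\mathcal A\circ\mathcal B=(\mathbf A_1\otimes\mathbf B_1,\bigoplus_n\mathbf A_n\otimes\mathbf B_n)$ (subalgebra of $\mathbf A\otimes\mathbf B$) and unit $\mathcal K=(\Bbbk e,\Bbbk[e])$. $\mathfrak H:\mathrm{CA}\to\mathrm{GrVct}$ is the forgetful functor to $\mathbb N_0$-graded vector spaces (arrows: degree-preserving linear maps); it is monoidal for $\mathbf V\circ\mathbf W=\bigoplus_n\mathbf V_n\otimes\mathbf W_n$. Cochains. $\mathfrak C^n[V]$ is the group of linear automorphisms of $(V^{\otimes})^{\otimes n}$ preserving each $V^{\otimes r_1}\otimes\cdots\otimes V^{\otimes r_n}$; the identity of $\mathfrak C^n[V]$ is written $\mathbb I^{\otimes n}$. For $\psi\in\mathfrak C^2[V]$ let $\psi_{r,s}$ be its restriction to $V^{\otimes r}\otimes V^{\otimes s}$. $\mathfrak Z^2[V]\subset\mathfrak C^2[V]$ is the set of counital 2-cocycles: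 $\psi_{0,s}=\mathrm{id}$, $\psi_{r,0}=\mathrm{id}$, and $\psi_{r,s+t}(\mathrm{id}\otimes\psi_{s,t})=\psi_{r+s,t}(\psi_{r,s}\otimes\mathrm{id})$ on $V^{\otimes(r+s+t)}$ for all $r,s,t$. For $\psi\in\mathfrak C^2[V]$ with $V$ finite-dimensional, $\psi^{!}\in\mathfrak C^2[V^*]$ is the inverse transpose, $(\psi^!)_{r,s}=(\psi_{r,s}^{*})^{-1}$, where $(V^* )^{\otimes r}$ is identified with $(V^{\otimes r})^*$ without reversing the order of factors. For $\alpha,\beta,\gamma$ in $\mathfrak C^n[U],\mathfrak C^n[V],\mathfrak C^n[W]$, $\mathfrak j(\alpha,\beta,\gamma)\in\mathfrak C^n[U\otimes V\otimes W]$ is $\alpha\otimes\beta\otimes\gamma$ acting degree by degree via the canonical rearrangement $(U\otimes V\otimes W)^{\otimes r}\cong U^{\otimes r}\otimes V^{\otimes r}\otimes W^{\otimes r}$; it sends counital 2-cocycles to counital 2-cocycles. Twisting. For $\mathcal A\in\mathrm{CA}$, $\psi\in\mathfrak Z^2[\mathbf A_1]$ is $\mathcal A$-admissible if each $\psi_{r,s}$ maps the kernel of $\mathbf A_1^{\otimes r}\otimes\mathbf A_1^{\otimes s}\to\mathbf A_r\otimes\mathbf A_s$ onto itself. Then $\mathcal A_\psi$ is the conic quantum space with the same graded vector space $\mathbf A$, the same generators $\mathbf A_1$, and product $m\circ\psi$, where $m$ is the product of $\mathbf A$ and $\psi$ also denotes the induced automorphism of $\mathbf A\otimes\mathbf A$.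 The category $\mathfrak H\mathrm{CA}^\circ$. For $\mathcal A,\mathcal B\in\mathrm{CA}$, the comma category $(\mathfrak H(\mathcal A)\downarrow\mathfrak H(\mathrm{CA}\circ\mathcal B))$ has objects $\langle\varphi,\mathcal H\rangle$ with $\mathcal H\in\mathrm{CA}$ and $\varphi:\mathfrak H(\mathcal A)\to\mathfrak H(\mathcal H\circ\mathcal B)$ in $\mathrm{GrVct}$; an arrow $\langle\varphi,\mathcal H\rangle\to\langle\varphi',\mathcal H'\rangle$ is a morphism $\alpha:\mathcal H\to\mathcal H'$ of $\mathrm{CA}$ with $\varphi'=(\alpha\circ I_B)\varphi$. $\mathfrak H\mathrm{CA}^{\circ}$ is the disjoint union of these categories over all $(\mathcal A,\mathcal B)$. It is a semigroupoid (a category with an associative partial product functor and units): the product of $\langle\varphi,\mathcal H\rangle\in(\mathfrak H(\mathcal A)\downarrow\mathfrak H(\mathrm{CA}\circ\mathcal C))$ and $\langle\chi,\mathcal G\rangle\in(\mathfrak H(\mathcal C)\downarrow\mathfrak H(\mathrm{CA}\circ\mathcal B))$ is $\langle(I_H\circ\chi)\varphi,\mathcal H\circ\mathcal G\rangle\in(\mathfrak H(\mathcal A)\downarrow\mathfrak H(\mathrm{CA}\circ\mathcal B))$, with $(\alpha,\beta)\mapsto\alpha\circ\beta$ on arrows, and the units are $\langle\ell_{\mathcal A},\mathcal K\rangle$, $\ell_{\mathcal A}(a)=e^n\otimes a$ for $a\in\mathbf A_n$. A sub-semigroupoid is a subcategory closed under the partial product and containing the units; $\circ_\Omega$ denotes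 the restriction of this partial product to $\Omega^\cdot$, which for a factorizable collection is such a sub-semigroupoid. The categories $\Omega$. Let $\{a_i\},\{b_j\}$ be bases of $\mathbf A_1,\mathbf B_1$ and $\{b^j\}$ the dual basis of $\mathbf B_1^*$. For an object $\langle\varphi,\mathcal H\rangle$ of the comma category $(\mathfrak H(\mathcal A)\downarrow\mathfrak H(\mathrm{CA}\circ\mathcal B))$ write $\varphi(a_i)=\sum_j h_i^j\otimes b_j$. Let $\mathbf H_1^\varphi=\mathrm{span}\{h_i^j\}\subset\mathbf H_1$, $\mathfrak F\langle\varphi,\mathcal H\rangle=\mathcal H^\varphi=(\mathbf H_1^\varphi,\mathbf H^\varphi)$ with $\mathbf H^\varphi$ the subalgebra of $\mathbf H$ generated by $\mathbf H_1^\varphi$, and $\pi^\varphi:\mathbf B_1^*\otimes\mathbf A_1\twoheadrightarrow\mathbf H_1^\varphi$, $b^j\otimes a_i\mapsto h_i^j$. Given $\omega\in\mathfrak Z^2[\mathbf B_1^*\otimes\mathbf A_1\otimes\mathbf B_1]$, say that $\omega$ defines a 2-cocycle twisting on $\mathcal H^\varphi\circ\mathcal B$ if $\omega$ descends along the surjection induced by $\pi^\varphi\otimes\mathrm{id}_{\mathbf B_1}$ to an element of $\mathfrak Z^2[\mathbf H_1^\varphi\otimes\mathbf B_1]$ (again written $\omega$) and the latter is $(\mathcal H^\varphi\circ\mathcal B)$-admissible. Given a collection $\omega_{\mathcal A,\mathcal B}\in\mathfrak Z^2[\mathbf B_1^*\otimes\mathbf A_1\otimes\mathbf B_1]$, $\Omega^{\mathcal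 A,\mathcal B}$ is the full subcategory of $(\mathfrak H(\mathcal A)\downarrow\mathfrak H(\mathrm{CA}\circ\mathcal B))$ of those $\langle\varphi,\mathcal H\rangle$ such that $\omega=\omega_{\mathcal A,\mathcal B}$ defines a 2-cocycle twisting on $\mathcal H^\varphi\circ\mathcal B$ and $\varphi$ is a morphism $\mathcal A\to(\mathcal H^\varphi\circ\mathcal B)_\omega$ in $\mathrm{CA}$. $\Omega^\cdot$ is the disjoint union of the $\Omega^{\mathcal A,\mathcal B}$. The collection is factorizable if there are $\psi_{\mathcal A}\in\mathfrak Z^2[\mathbf A_1]$ ($\mathcal A\in\mathrm{CA}$) with $\omega_{\mathcal A,\mathcal B}=\mathfrak j(\psi_{\mathcal B}^!,\psi_{\mathcal A},\mathbb I^{\otimes2})$ for all $\mathcal A,\mathcal B$.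
   Formalization: Ω need not be closed under the partial product (closure can fail when C_n = 0 but B_n ≠ 0), so the first equality is stated for composable pairs whose product lies in Ω; units are shown to lie in Ω, and closure is asserted when C_n = 0 implies B_n = 0 for all n. *)

(* Defs.v *)
From HB Require Import structures.
From mathcomp Require Import all_boot all_algebra.
From mathcomp Require Import boolp.

Set Implicit Arguments.
Unset Strict Implicit.
Unset Printing Implicit Defensive.

Import GRing.Theory.
Local Open Scope ring_scope.

Section Tensor.
Variable k : fieldType.
Implicit Types U V W Z : vectType k.

Definition dual V : vectType k := 'Hom(V, k^o).

(* U (x) V, realised as Hom(U^*, V): the pure tensor u (x) v is the map
   xi |-> xi(u) v. *)
Definition tens U V : vectType k := 'Hom(dual U, V).

Definition tpure U V (u : U) (v : V) : tens U V :=
  linfun (fun xi : dual U => (xi u : k) *: v).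

Definition dcoord V (i : 'I_(\dim {:V})) : dual V :=
  linfun (coord (vbasis {:V}) i : V -> k^o).

(* The linear map U (x) V -> W with u (x) v |-> f u v, for f bilinear
   (tlift_pure). *)
Definition tlift U V W (f : U -> V -> W) : 'Hom(tens U V, W) :=
  linfun (fun M : tens U V =>
    \sum_(i < \dim {:U})
       f (vbasis {:U})`_i ((M : 'Hom(dual U, V)) (dcoord i))).

Local Notation bilin f := (bilinear_for *:%R *:%R f).

Lemma linfunE U V (f : U -> V) : linear f -> linfun f =1 f.
Proof.
move=> L u; pose m := GRing.isLinear.Build _ _ _ _ _ L.
pose F : {linear U -> V} := HB.pack f m.
exact: (lfunE F).
Qed.

Lemma bilin_sumr U V W (f : U -> V -> W) (hf : bilin f) u I r (P : pred I) F :
  f u (\sum_(i <- r | P i) F i) = \sum_(i <- r | P i) f u (F i).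
Proof.
pose m := GRing.isLinear.Build _ _ _ _ _ (hf.2 u).
pose G : {linear V -> W} := HB.pack (f u) m.
exact: (raddf_sum G).
Qed.

Lemma bilin_suml U V W (f : U -> V -> W) (hf : bilin f) v I r (P : pred I) F :
  f (\sum_(i <- r | P i) F i) v = \sum_(i <- r | P i) f (F i) v.
Proof.
pose m := GRing.isLinear.Build _ _ _ _ _ (hf.1 v).
pose G : {linear U -> W} := HB.pack (f^~ v) m.
exact: (raddf_sum G).
Qed.

Lemma bilinZl U V W (f : U -> V -> W) (hf : bilin f) a u v :
  f (a *: u) v = a *: f u v.
Proof.
pose m := GRing.isLinear.Build _ _ _ _ _ (hf.1 v).
pose G : {linear U -> W} := HB.pack (f^~ v) m.
exact: (linearZ_LR G).
Qed.

Lemma bilinZr U V W (f : U -> V -> W) (hf : bilin f) a u v :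
  f u (a *: v) = a *: f u v.
Proof.
pose m := GRing.isLinear.Build _ _ _ _ _ (hf.2 u).
pose G : {linear V -> W} := HB.pack (f u) m.
exact: (linearZ_LR G).
Qed.

Lemma bilinDl U V W (f : U -> V -> W) (hf : bilin f) u u' v :
  f (u + u') v = f u v + f u' v.
Proof. by have := hf.1 v 1 u u'; rewrite /= !scale1r. Qed.

Lemma bilinDr U V W (f : U -> V -> W) (hf : bilin f) u v v' :
  f u (v + v') = f u v + f u v'.
Proof. by have := hf.2 u 1 v v'; rewrite /= !scale1r. Qed.

Lemma bilin0l U V W (f : U -> V -> W) (hf : bilin f) v : f 0 v = 0.
Proof. by rewrite -[0 in LHS](scale0r (0 : U)) bilinZl // scale0r. Qed.

Lemma bilin0r U V W (f : U -> V -> W) (hf : bilin f) u : f u 0 = 0.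
Proof. by rewrite -[0 in LHS](scale0r (0 : V)) bilinZr // scale0r. Qed.

Lemma tpureE U V (u : U) (v : V) (xi : dual U) :
  (tpure u v : 'Hom(dual U, V)) xi = (xi u : k) *: v.
Proof.
apply: (linfunE (f := fun xi : dual U => (xi u : k) *: v)) => a x y.
by rewrite !lfun_simp /= scalerDl scalerA.
Qed.

Lemma tpure_bilin U V : bilin (@tpure U V).
Proof.
split=> [v a x y|u a x y] /=; apply/lfunP => xi; rewrite !lfun_simp /=.
  by rewrite !tpureE linearP /= scalerDl scalerA.
by rewrite !tpureE scalerDr !scalerA mulrC.
Qed.

Lemma dcoordE V i v : dcoord i v = coord (vbasis {:V}) i v.
Proof.
apply: (linfunE (f := coord (vbasis {:V}) i : V -> k^o)) => a x y.
by rewrite linearP.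
Qed.

Lemma tliftE U V W (f : U -> V -> W) (M : tens U V) : bilin f ->
  tlift f M = \sum_(i < \dim {:U})
       f (vbasis {:U})`_i ((M : 'Hom(dual U, V)) (dcoord i)).
Proof.
move=> hf.
apply: (linfunE (f := fun M : tens U V => \sum_(i < \dim {:U})
       f (vbasis {:U})`_i ((M : 'Hom(dual U, V)) (dcoord i)))) => a x y.
rewrite scaler_sumr -big_split /=; apply: eq_bigr => i _.
by rewrite !lfun_simp (bilinDr hf) (bilinZr hf).
Qed.

Lemma tlift_pure U V W (f : U -> V -> W) u v :
  bilin f -> tlift f (tpure u v) = f u v.
Proof.
move=> hf; rewrite (tliftE _ hf) [in RHS](coord_vbasis (memvf u)).
rewrite (bilin_suml hf); apply: eq_bigr => i _.
by rewrite tpureE dcoordE (bilinZl hf) (bilinZr hf).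
Qed.

Lemma tens_sum U V (M : tens U V) :
  M = \sum_(i < \dim {:U})
         tpure (vbasis {:U})`_i ((M : 'Hom(dual U, V)) (dcoord i)).
Proof.
apply/lfunP => xi; rewrite sum_lfunE.
have -> : xi = \sum_(i < \dim {:U}) (xi (vbasis {:U})`_i : k) *: dcoord i.
  apply/lfunP => u; rewrite sum_lfunE {1}(coord_vbasis (memvf u)) linear_sum.
  apply: eq_bigr => i _; rewrite scale_lfunE linearZ dcoordE; exact: mulrC.
rewrite linear_sum; apply: eq_bigr => i _ /=; rewrite linearZ /=.
rewrite tpureE sum_lfunE; congr (_ *: _).
rewrite (bigD1 i) //= big1 ?addr0 => [|j ne]; rewrite scale_lfunE dcoordE.
  rewrite coord_free ?(basis_free (vbasisP _)) // eqxx.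
  exact: (esym (mulr1 _)).
rewrite coord_free ?(basis_free (vbasisP _)) // eq_sym (negbTE ne).
exact: mulr0.
Qed.

Lemma tens_ext U V W (f g : 'Hom(tens U V, W)) :
  (forall u v, f (tpure u v) = g (tpure u v)) -> f = g.
Proof.
move=> fg; apply/lfunP => M; rewrite (tens_sum M) !linear_sum.
by apply: eq_bigr => i _; exact: fg.
Qed.

Lemma tens_ind U V (P : tens U V -> Prop) :
  P 0 -> (forall x y, P x -> P y -> P (x + y)) -> (forall u v, P (tpure u v)) ->
  forall M, P M.
Proof.
move=> P0 PD Pp M; rewrite (tens_sum M).
by elim/big_ind: _ => // i _; apply: Pp.
Qed.

Lemma tpurePl U V a (x y : U) (v : V) :
  tpure (a *: x + y) v = a *: tpure x v + tpure y v.
Proof. exact: (tpure_bilin U V).1. Qed.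

Lemma tpurePr U V a (u : U) (x y : V) :
  tpure u (a *: x + y) = a *: tpure u x + tpure u y.
Proof. exact: (tpure_bilin U V).2. Qed.

Lemma tlift_param U V W Z (f : Z -> U -> V -> W) :
  (forall z, bilin (f z)) -> (forall u v, linear (fun z => f z u v)) ->
  forall M, linear (fun z => tlift (f z) M).
Proof.
move=> hf hz M a x y; rewrite !tliftE // scaler_sumr -big_split /=.
by apply: eq_bigr => i _; rewrite hz.
Qed.

End Tensor.
Section TensorMaps.
Variable k : fieldType.
Implicit Types U V W Z : vectType k.
Local Notation bilin f := (bilinear_for *:%R *:%R f).

Definition tmap U V U' V' (f : 'Hom(U, U')) (g : 'Hom(V, V')) :
    'Hom(tens U V, tens U' V') :=
  tlift (fun u v => tpure (f u) (g v)).

Lemma tmap_bilin U V U' V' (f : 'Hom(U, U')) (g : 'Hom(V, V')) :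
  bilin (fun u v => tpure (f u) (g v)).
Proof.
by split=> [v a x y|u a x y] /=; rewrite linearP /= ?tpurePl ?tpurePr.
Qed.

Lemma tmap_pure U V U' V' (f : 'Hom(U, U')) (g : 'Hom(V, V')) u v :
  tmap f g (tpure u v) = tpure (f u) (g v).
Proof. by rewrite /tmap tlift_pure //; exact: tmap_bilin. Qed.

Lemma tmap_comp U V U' V' U'' V'' (f' : 'Hom(U', U'')) (g' : 'Hom(V', V''))
    (f : 'Hom(U, U')) (g : 'Hom(V, V')) :
  (tmap f' g' \o tmap f g)%VF = tmap (f' \o f)%VF (g' \o g)%VF.
Proof. by apply: tens_ext => u v; rewrite comp_lfunE !tmap_pure !comp_lfunE. Qed.

Lemma tmap_id U V : tmap \1%VF \1%VF = \1%VF :> 'Hom(tens U V, tens U V).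
Proof. by apply: tens_ext => u v; rewrite tmap_pure !id_lfunE. Qed.

Lemma lfun_cancel_ker0 U V (f : 'Hom(U, V)) (g : 'Hom(V, U)) :
  (g \o f)%VF = \1%VF -> lker f == 0%VS.
Proof.
move=> gf; apply/lker0P; apply: (can_inj (g := g)) => u.
by rewrite -comp_lfunE gf id_lfunE.
Qed.

Lemma lfun_cancel_surj U V (f : 'Hom(U, V)) (g : 'Hom(V, U)) :
  (f \o g)%VF = \1%VF -> limg f = fullv.
Proof.
move=> fg; apply/eqP; rewrite eqEsubv subvf; apply/subvP => v _.
by rewrite -[v]id_lfunE -fg comp_lfunE memv_img ?memvf.
Qed.

Lemma surj_compfV U V (f : 'Hom(U, V)) :
  limg f = fullv -> (f \o f^-1)%VF = \1%VF.
Proof.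
move=> fs; apply/lfunP => v.
by rewrite comp_lfunE id_lfunE limg_lfunVK // fs memvf.
Qed.

Lemma tmap_ker0 U V U' V' (f : 'Hom(U, U')) (g : 'Hom(V, V')) :
  lker f == 0%VS -> lker g == 0%VS -> lker (tmap f g) == 0%VS.
Proof.
move=> hf hg; apply: (@lfun_cancel_ker0 _ _ _ (tmap f^-1 g^-1)%VF).
by rewrite tmap_comp !lker0_compVf // tmap_id.
Qed.

Lemma tmap_surj U V U' V' (f : 'Hom(U, U')) (g : 'Hom(V, V')) :
  limg f = fullv -> limg g = fullv -> limg (tmap f g) = fullv.
Proof.
move=> hf hg; apply: (@lfun_cancel_surj _ _ _ (tmap f^-1 g^-1)%VF).
by rewrite tmap_comp !surj_compfV // tmap_id.
Qed.

Definition tassoc U V W : 'Hom(tens U (tens V W), tens (tens U V) W) :=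
  tlift (fun u y => tlift (fun v w => tpure (tpure u v) w) y).

Lemma tassoc_pure U V W (u : U) (v : V) (w : W) :
  tassoc U V W (tpure u (tpure v w)) = tpure (tpure u v) w.
Proof.
have b u' : bilin (fun (v : V) (w : W) => tpure (tpure u' v) w).
  by split=> [? a x y|? a x y] /=; rewrite ?(tpurePl, tpurePr).
rewrite /tassoc tlift_pure ?tlift_pure //.
split=> [y|u'] /=; last by move=> a x y; rewrite linearP.
by apply: tlift_param => // v' w' a x z; rewrite !tpurePl.
Qed.

Definition tswap U V U' V' :
    'Hom(tens (tens U V) (tens U' V'), tens (tens U U') (tens V V')) :=
  tlift (fun x y => tlift (fun u v =>
    tlift (fun u' v' => tpure (tpure u u') (tpure v v')) y) x).

Lemma tswap_pure U V U' V' (u : U) (v : V) (u' : U') (v' : V') :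
  tswap U V U' V' (tpure (tpure u v) (tpure u' v')) =
  tpure (tpure u u') (tpure v v').
Proof.
have b1 u0 v0 :
    bilin (fun (u1 : U') (v1 : V') => tpure (tpure u0 u1) (tpure v0 v1)).
  by split=> [? a x y|? a x y] /=; rewrite ?(tpurePl, tpurePr).
have b2 y : bilin (fun (u : U) (v : V) =>
    tlift (fun (u1 : U') (v1 : V') => tpure (tpure u u1) (tpure v v1)) y).
  split=> [v2|u2]; apply: tlift_param => // ? ? a x z; 
    by rewrite ?(tpurePl, tpurePr).
rewrite /tswap tlift_pure ?tlift_pure //.
split=> [y a x z|x] /=; first by rewrite linearP.
by apply: tlift_param => // u2 v2 a y z; rewrite linearP.
Qed.

(* The n-th tensor power of V. *)
Fixpoint tpow V n : vectType k :=
  if n is m.+1 then tens V (tpow V m) else k^o.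

Definition tpow1 V : tpow V 0 := (1 : k^o).

(* The product x (x) y of the tensor algebra. *)
Fixpoint tcat V r s : tpow V r -> tpow V s -> tpow V (r + s) :=
  match r return tpow V r -> tpow V s -> tpow V (r + s) with
  | 0 => fun c y => (c : k) *: y
  | r'.+1 => fun x y => tlift (fun v x' => tpure v (tcat x' y)) x
  end.

Lemma tcat_bilin V r s : bilin (@tcat V r s).
Proof.
elim: r => [|r IH].
  split=> [y a c d|c a x y] /=; first by rewrite scalerDl scalerA.
  by rewrite scalerDr !scalerA mulrC.
have b y : bilin (fun (v : V) (x' : tpow V r) => tpure v (@tcat V r s x' y)).
  split=> [x' a v w|v a x x'] /=; first by rewrite tpurePl.
  by rewrite (IH.1 y) /= tpurePr.
split=> [y a x z|x] /=; first by rewrite linearP.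
by apply: tlift_param => // v x' a y z; rewrite (IH.2 x') /= tpurePr.
Qed.

Lemma tcat0 V s c (y : tpow V s) : tcat (c : tpow V 0) y = (c : k) *: y.
Proof. by []. Qed.

Lemma tcat1 V s (y : tpow V s) : tcat (tpow1 V) y = y.
Proof. exact: scale1r. Qed.

Lemma tcatS V r s (v : V) (x : tpow V r) (y : tpow V s) :
  tcat (tpure v x : tpow V r.+1) y = tpure v (tcat x y).
Proof.
rewrite /= tlift_pure //.
split=> [x' a u w|u a z x'] /=; first by rewrite tpurePl.
by rewrite (tcat_bilin V r s).1 /= tpurePr.
Qed.

Lemma tpow_ind V r (P : tpow V r.+1 -> Prop) :
  P 0 -> (forall x y, P x -> P y -> P (x + y)) ->
  (forall v x, P (tpure v x : tpow V r.+1)) -> forall x, P x.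
Proof. exact: tens_ind. Qed.

Lemma tpow_ext V W r (f g : 'Hom(tpow V r.+1, W)) :
  (forall v x, f (tpure v x : tpow V r.+1) = g (tpure v x : tpow V r.+1)) ->
  f = g.
Proof. exact: tens_ext. Qed.

#[global] Arguments tcat : simpl never.

Definition tcatl V r s : 'Hom(tens (tpow V r) (tpow V s), tpow V (r + s)) :=
  tlift (@tcat V r s).

Lemma tcatl_pure V r s x y : tcatl V r s (tpure x y) = tcat x y.
Proof. by rewrite /tcatl tlift_pure //; exact: tcat_bilin. Qed.

Fixpoint tpmap U V (f : 'Hom(U, V)) n : 'Hom(tpow U n, tpow V n) :=
  if n is m.+1 then tmap f (tpmap f m) else \1%VF.

Lemma tpmap0 U V (f : 'Hom(U, V)) (c : tpow U 0) : tpmap f 0 c = c.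
Proof. by rewrite /= id_lfunE. Qed.

Lemma tpmapS U V (f : 'Hom(U, V)) n (u : U) (x : tpow U n) :
  tpmap f n.+1 (tpure u x : tpow U n.+1) = tpure (f u) (tpmap f n x).
Proof. by rewrite /= tmap_pure. Qed.

Lemma tpmap_cat U V (f : 'Hom(U, V)) r s (x : tpow U r) (y : tpow U s) :
  tpmap f (r + s) (tcat x y) = tcat (tpmap f r x) (tpmap f s y).
Proof.
elim: r x => [|r IH] x; first by rewrite tpmap0 !tcat0 linearZ.
elim/tpow_ind: x => [|x1 x2 h1 h2|v x].
- by rewrite !(bilin0l (tcat_bilin _ _ _), linear0).
- by rewrite (bilinDl (tcat_bilin _ _ _)) !linearD (bilinDl (tcat_bilin _ _ _))
    -h1 -h2.
by rewrite tcatS !tpmapS IH tcatS.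
Qed.

Lemma tpmap_comp U V W (g : 'Hom(V, W)) (f : 'Hom(U, V)) n :
  (tpmap g n \o tpmap f n)%VF = tpmap (g \o f)%VF n.
Proof.
by elim: n => [|n IH] /=; [rewrite comp_lfun1l | rewrite tmap_comp IH].
Qed.

Lemma tpmap_id U n : tpmap \1%VF n = \1%VF :> 'Hom(tpow U n, tpow U n).
Proof. by elim: n => [|n IH] //=; rewrite IH tmap_id. Qed.

Lemma tpmap_ker0 U V (f : 'Hom(U, V)) n :
  lker f == 0%VS -> lker (tpmap f n) == 0%VS.
Proof.
move=> hf; apply: (@lfun_cancel_ker0 _ _ _ (tpmap f^-1 n)%VF).
by rewrite tpmap_comp lker0_compVf // tpmap_id.
Qed.

(* (U (x) V)^(x)n -> U^(x)n (x) V^(x)n *)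
Fixpoint tshuf U V n :
    'Hom(tpow (tens U V) n, tens (tpow U n) (tpow V n)) :=
  match n return 'Hom(tpow (tens U V) n, tens (tpow U n) (tpow V n)) with
  | 0 => linfun (fun c : k^o => (c : k) *: tpure (tpow1 U) (tpow1 V))
  | m.+1 => (tswap U V (tpow U m) (tpow V m) \o tmap \1 (tshuf U V m))%VF
  end.

Lemma tshuf0 U V (c : tpow (tens U V) 0) :
  tshuf U V 0 c = (c : k) *: tpure (tpow1 U) (tpow1 V).
Proof.
apply: (linfunE (f := fun c : k^o => (c : k) *: tpure (tpow1 U) (tpow1 V))).
by move=> a x y; rewrite scalerDl scalerA.
Qed.

Lemma tshufS U V n (w : tens U V) (x : tpow (tens U V) n) :
  tshuf U V n.+1 (tpure w x : tpow (tens U V) n.+1) =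
  tswap U V (tpow U n) (tpow V n) (tpure w (tshuf U V n x)).
Proof. by rewrite /= comp_lfunE tmap_pure id_lfunE. Qed.

(* (U (x) V (x) W)^(x)n -> U^(x)n (x) V^(x)n (x) W^(x)n *)
Definition tshuf3 U V W n :
    'Hom(tpow (tens (tens U V) W) n,
         tens (tens (tpow U n) (tpow V n)) (tpow W n)) :=
  (tmap (tshuf U V n) \1 \o tshuf (tens U V) W n)%VF.

(* (V^* )^(x)n -> (V^(x)n)^*, order of factors preserved *)
Definition dtens U V : 'Hom(tens (dual U) (dual V), dual (tens U V)) :=
  tlift (fun (xi : dual U) (eta : dual V) =>
    tlift (fun u v => (xi u : k) *: eta v)).

Fixpoint tdual V n : 'Hom(tpow (dual V) n, dual (tpow V n)) :=
  match n return 'Hom(tpow (dual V) n, dual (tpow V n)) with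
  | 0 => linfun (fun c : k^o => (c : k) *: (\1%VF : dual k^o))
  | m.+1 => (dtens V (tpow V m) \o tmap \1 (tdual V m))%VF
  end.

Definition transp U V (f : 'Hom(U, V)) : 'Hom(dual V, dual U) :=
  linfun (fun xi : dual V => (xi \o f)%VF : dual U).

End TensorMaps.
Section Cochains.
Variable k : fieldType.
Implicit Types U V W Z : vectType k.

(* Degree-preserving endomorphisms psi_{r,s} of
   V^(x)r (x) V^(x)s = V^(x)(r+s). *)
Definition cochain2 V := forall r s, 'End(tpow V (r + s)).

Definition is_C2 V (psi : cochain2 V) := forall r s, lker (psi r s) == 0%VS.

Definition id_cochain V : cochain2 V := fun r s => \1%VF.

Definition counital V (psi : cochain2 V) :=
  (forall s, psi 0 s = \1%VF) /\ (forall r, psi r 0 = \1%VF).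

(* psi_{r,s+t} (id (x) psi_{s,t}) = psi_{r+s,t} (psi_{r,s} (x) id), evaluated at
   x (x) y (x) z; the cast only reassociates r + (s + t). *)
Definition cocycle V (psi : cochain2 V) :=
  forall r s t (x : tpow V r) (y : tpow V s) (z : tpow V t),
    ecast n (tpow V n) (addnA r s t)
      (psi r (s + t) (tcat x (psi s t (tcat y z)))) =
    psi (r + s) t (tcat (psi r s (tcat x y)) z).

Definition is_Z2 V (psi : cochain2 V) :=
  [/\ is_C2 psi, counital psi & cocycle psi].

(* psi^!, the inverse transpose, transported along the identification tdual. *)
Definition dual_cochain V (psi : cochain2 V) : cochain2 (dual V) := fun r s =>
  ((tdual V (r + s))^-1 \o ((transp (psi r s))^-1 \o tdual V (r + s)))%VF.

Definition join_cochain U V W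
    (a : cochain2 U) (b : cochain2 V) (c : cochain2 W) :
    cochain2 (tens (tens U V) W) := fun r s =>
  ((tshuf3 U V W (r + s))^-1 \o
    (tmap (tmap (a r s) (b r s)) (c r s) \o tshuf3 U V W (r + s)))%VF.

End Cochains.

Section ConicSpaces.
Variable k : fieldType.
Implicit Types U V W Z : vectType k.

(* The graded algebra A = A_1^(x) / I is given by the quotient spaces
   A_n = A_1^(x)n / I_n together with the canonical projections, so that
   I_n = lker (cproj n); I_n = 0 for n < 2. *)
Record cqs := Cqs {
  gens : vectType k;
  piece : nat -> vectType k;
  cproj : forall n, 'Hom(tpow gens n, piece n);
  cproj_surj : forall n, limg (cproj n) = fullv;
  cproj0_inj : lker (cproj 0) == 0%VS;
  cproj1_inj : lker (cproj 1) == 0%VS;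
  cideal_l : forall r s (x : tpow gens r) (y : tpow gens s),
    cproj s y = 0 -> cproj (r + s) (tcat x y) = 0;
  cideal_r : forall r s (x : tpow gens r) (y : tpow gens s),
    cproj r x = 0 -> cproj (r + s) (tcat x y) = 0
}.

(* The data of a graded algebra; the laws are not needed. *)
Record gralg := Gralg {
  gpiece : nat -> vectType k;
  gone : gpiece 0;
  gmul : forall r s, 'Hom(tens (gpiece r) (gpiece s), gpiece (r + s))
}.

(* Unital algebra maps. A unital algebra map between conic quantum spaces that
   sends generators to generators preserves the degree, hence is such a family;
   conversely the degree 1 component sends generators to generators. *)
Definition is_algmap (X Y : gralg) (f : forall n, 'Hom(gpiece X n, gpiece Y n)) :=
  f 0 (gone X) = gone Y /\
  forall r s, (f (r + s) \o gmul X r s = gmul Y r s \o tmap (f r) (f s))%VF.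

Section Algebra.
Variable A : cqs.

Definition cone : piece A 0 := cproj A 0 (tpow1 (gens A)).

(* The product of A_1^(x) / I, computed on representatives (cmulE). *)
Definition cmul r s : 'Hom(tens (piece A r) (piece A s), piece A (r + s)) :=
  tlift (fun a b => cproj A (r + s) (tcat ((cproj A r)^-1%VF a)
                                          ((cproj A s)^-1%VF b))).

Definition calg : gralg := Gralg cone cmul.

(* The inclusion of the generators, A_1 -> A. *)
Definition cgen : 'Hom(gens A, piece A 1) :=
  (cproj A 1 \o linfun (fun v => tpure v (tpow1 (gens A)) : tpow (gens A) 1))%VF.

(* A_1^(x)r (x) A_1^(x)s -> A_r (x) A_s *)
Definition cproj2 r s :
    'Hom(tpow (gens A) (r + s), tens (piece A r) (piece A s)) :=
  (tmap (cproj A r) (cproj A s) \o (tcatl (gens A) r s)^-1)%VF.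

Definition admissible (psi : cochain2 (gens A)) := forall r s,
  (psi r s @: lker (cproj2 r s))%VS = lker (cproj2 r s).

(* The automorphism of A_r (x) A_s induced by an admissible psi. *)
Definition induced (psi : cochain2 (gens A)) r s :
    'End(tens (piece A r) (piece A s)) :=
  (cproj2 r s \o (psi r s \o (cproj2 r s)^-1))%VF.

(* A_psi: the graded space of A with the product m o psi. *)
Definition twist (psi : cochain2 (gens A)) : gralg :=
  Gralg cone (fun r s => cmul r s \o induced psi r s)%VF.

Lemma cprojVK n : cancel ((cproj A n)^-1%VF) (cproj A n).
Proof. by move=> a; rewrite limg_lfunVK // cproj_surj memvf. Qed.

Lemma cproj_tcat_eq r s (x x' : tpow (gens A) r) (y y' : tpow (gens A) s) :
  cproj A r x = cproj A r x' -> cproj A s y = cproj A s y' ->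
  cproj A (r + s) (tcat x y) = cproj A (r + s) (tcat x' y').
Proof.
move=> hx hy; have tb := tcat_bilin (gens A) r s.
have -> : tcat x y = tcat x' y' + (tcat (x - x') y + tcat x' (y - y')).
  have h1 : tcat x y = tcat x' y + tcat (x - x') y.
    by rewrite -(bilinDl tb) addrC subrK.
  have h2 : tcat x' y = tcat x' y' + tcat x' (y - y').
    by rewrite -(bilinDr tb) addrC subrK.
  by rewrite h1 h2 addrAC addrA.
have e1 : cproj A (r + s) (tcat (x - x') y) = 0.
  by apply: cideal_r; rewrite linearB /= hx subrr.
have e2 : cproj A (r + s) (tcat x' (y - y')) = 0.
  by apply: cideal_l; rewrite linearB /= hy subrr.
by rewrite !linearD /= e1 e2 !addr0.
Qed.

Lemma cmul_bilin r s : bilinear_for *:%R *:%R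
  (fun a b => cproj A (r + s) (tcat ((cproj A r)^-1%VF a)
                                          ((cproj A s)^-1%VF b))).
Proof.
have tb := tcat_bilin (gens A) r s.
split=> [b|a] c x y /=.
  by rewrite linearP (tb.1 _) linearP.
by rewrite linearP (tb.2 _) linearP.
Qed.

Lemma cmulE r s (x : tpow (gens A) r) (y : tpow (gens A) s) :
  cmul r s (tpure (cproj A r x) (cproj A s y)) = cproj A (r + s) (tcat x y).
Proof.
rewrite /cmul tlift_pure; last exact: cmul_bilin.
by apply: cproj_tcat_eq; rewrite cprojVK.
Qed.

End Algebra.

Record cahom (A B : cqs) := CaHom {
  camap :> forall n, 'Hom(piece A n, piece B n);
  camapP : is_algmap (X := calg A) (Y := calg B) camap
}.

(* Monoidal unit k[e]; e^n is the basis vector 1 of piece n. *)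
Fixpoint cunit_proj n : 'Hom(tpow k^o n, k^o) :=
  match n return 'Hom(tpow k^o n, k^o) with
  | 0 => \1%VF
  | m.+1 => tlift (fun (a : k^o) (x : tpow k^o m) => (a : k) *: cunit_proj m x)
  end.

Lemma cunit_projS n (a : k^o) (x : tpow k^o n) :
  cunit_proj n.+1 (tpure a x : tpow k^o n.+1) = (a : k) *: cunit_proj n x.
Proof.
rewrite /= tlift_pure //; split=> [y c u v|u c y z] /=.
  by rewrite scalerDl scalerA.
by rewrite linearP scalerDr !scalerA mulrC.
Qed.

Lemma cunit_proj_tcat r s (x : tpow k^o r) (y : tpow k^o s) :
  cunit_proj (r + s) (tcat x y) = (cunit_proj r x : k) *: cunit_proj s y.
Proof.
elim: r x => [|r IH] x; first by rewrite tcat0 linearZ /= id_lfunE.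
elim/tpow_ind: x => [|x1 x2 h1 h2|v x].
- by rewrite (bilin0l (tcat_bilin _ _ _)) !linear0 scale0r.
- by rewrite (bilinDl (tcat_bilin _ _ _)) !linearD scalerDl -h1 -h2.
by rewrite tcatS !cunit_projS IH scalerA.
Qed.

Fixpoint tone n : tpow k^o n :=
  match n return tpow k^o n with
  | 0 => (1 : k^o)
  | m.+1 => tpure (1 : k^o) (tone m)
  end.

Lemma cunit_proj_tone n : cunit_proj n (tone n) = 1.
Proof.
by elim: n => [|n IH]; [rewrite /= id_lfunE | rewrite cunit_projS IH scale1r].
Qed.

Lemma cunit_surj n : limg (cunit_proj n) = fullv.
Proof.
apply/eqP; rewrite eqEsubv subvf; apply/subvP => v _.
have -> : v = cunit_proj n ((v : k) *: tone n).
  by rewrite linearZ /= cunit_proj_tone; apply: esym; apply: mulr1.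
by rewrite memv_img ?memvf.
Qed.

Lemma cunit_inj0 : lker (cunit_proj 0) == 0%VS.
Proof. by apply/lker0P => x y; rewrite /= !id_lfunE. Qed.

Lemma cunit_inj1 : lker (cunit_proj 1) == 0%VS.
Proof.
apply: (@lfun_cancel_ker0 _ _ _ _
  (linfun (fun c : k^o => (c : k) *: tone 1))).
apply: tpow_ext => a x; rewrite comp_lfunE cunit_projS.
rewrite linfunE => [|c u v]; last by rewrite scalerDl scalerA.
rewrite /= !id_lfunE.
rewrite -[in RHS](mulr1 a) -[in RHS](mulr1 x).
by rewrite (bilinZl (tpure_bilin _ _)) (bilinZr (tpure_bilin _ _)) scalerA.
Qed.

Lemma cunit_ideal_l r s (x : tpow k^o r) (y : tpow k^o s) :
  cunit_proj s y = 0 -> cunit_proj (r + s) (tcat x y) = 0.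
Proof. by rewrite cunit_proj_tcat => ->; rewrite scaler0. Qed.

Lemma cunit_ideal_r r s (x : tpow k^o r) (y : tpow k^o s) :
  cunit_proj r x = 0 -> cunit_proj (r + s) (tcat x y) = 0.
Proof. by rewrite cunit_proj_tcat => ->; rewrite scale0r. Qed.

Definition cunit : cqs :=
  Cqs cunit_surj cunit_inj0 cunit_inj1 cunit_ideal_l cunit_ideal_r.

End ConicSpaces.
Section ShuffleTheory.
Variable k : fieldType.
Implicit Types U V W Z : vectType k.

Lemma ker0_comp U V W (g : 'Hom(V, W)) (f : 'Hom(U, V)) :
  lker g == 0%VS -> lker f == 0%VS -> lker (g \o f)%VF == 0%VS.
Proof.
move=> /lker0P hg /lker0P hf; apply/lker0P => x y.
by rewrite !comp_lfunE => /hg /hf.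
Qed.

Lemma surj_comp U V W (g : 'Hom(V, W)) (f : 'Hom(U, V)) :
  limg g = fullv -> limg f = fullv -> limg (g \o f)%VF = fullv.
Proof. by move=> hg hf; rewrite limg_comp hf. Qed.

Lemma tens_ext22 U V U' V' Z (f g : 'Hom(tens (tens U V) (tens U' V'), Z)) :
  (forall u v u' v', f (tpure (tpure u v) (tpure u' v')) =
                     g (tpure (tpure u v) (tpure u' v'))) -> f = g.
Proof.
move=> fg; apply: tens_ext => x y.
elim/tens_ind: x => [|x1 x2 h1 h2|u v].
- by rewrite (bilin0l (tpure_bilin _ _)) !linear0.
- by rewrite (bilinDl (tpure_bilin _ _)) !linearD /= h1 h2.
elim/tens_ind: y => [|x1 x2 h1 h2|u' v'] //.
- by rewrite (bilin0r (tpure_bilin _ _)) !linear0.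
by rewrite (bilinDr (tpure_bilin _ _)) !linearD /= h1 h2.
Qed.

Lemma tswapK U V U' V' :
  (tswap U U' V V' \o tswap U V U' V')%VF = \1%VF.
Proof.
by apply: tens_ext22 => u v u' v'; rewrite comp_lfunE !tswap_pure id_lfunE.
Qed.

Lemma tswap_ker0 U V U' V' : lker (tswap U V U' V') == 0%VS.
Proof. exact: lfun_cancel_ker0 (tswapK _ _ _ _). Qed.

Lemma tswap_surj U V U' V' : limg (tswap U V U' V') = fullv.
Proof. exact: lfun_cancel_surj (tswapK _ _ _ _). Qed.

Lemma tmap_tswap U V U' V' U1 V1 U1' V1' (f : 'Hom(U, U1)) (g : 'Hom(V, V1))
    (f' : 'Hom(U', U1')) (g' : 'Hom(V', V1')) :
  (tmap (tmap f f') (tmap g g') \o tswap U V U' V' =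
   tswap U1 V1 U1' V1' \o tmap (tmap f g) (tmap f' g'))%VF.
Proof.
apply: tens_ext22 => u v u' v'.
by rewrite !comp_lfunE !(tswap_pure, tmap_pure).
Qed.

Let tunit : 'Hom(tens (k^o : vectType k) (k^o : vectType k), k^o) :=
  tlift (fun a b : k^o => (a : k) *: b).

Let tunit_pure a b : tunit (tpure a b) = (a : k) *: b.
Proof.
rewrite /tunit tlift_pure //; split=> [y c u v|u c x y] /=.
  by rewrite scalerDl scalerA.
by rewrite scalerDr !scalerA mulrC.
Qed.

Lemma tshuf_bij U V n :
  lker (tshuf U V n) == 0%VS /\ limg (tshuf U V n) = fullv.
Proof.
elim: n => [|n [IH1 IH2]]; last first.
  split; first by rewrite ker0_comp ?tswap_ker0 // tmap_ker0 //
      (@lfun_cancel_ker0 _ _ _ _ \1%VF) // comp_lfun1l.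
  by rewrite surj_comp ?tswap_surj // tmap_surj // lim1g.
split.
  apply: (@lfun_cancel_ker0 _ _ _ _ tunit); apply/lfunP => c.
  rewrite comp_lfunE tshuf0 linearZ /= tunit_pure id_lfunE scale1r.
  exact: mulr1.
apply: (@lfun_cancel_surj _ _ _ _ tunit); apply: tens_ext => a b.
rewrite comp_lfunE tunit_pure tshuf0 id_lfunE.
rewrite -[in RHS](mulr1 a) -[in RHS](mulr1 b).
rewrite (bilinZl (tpure_bilin _ _)) (bilinZr (tpure_bilin _ _)).
by rewrite scalerA.
Qed.

Definition tcat2 U V r s (w : tens (tpow U r) (tpow V r))
    (w' : tens (tpow U s) (tpow V s)) : tens (tpow U (r + s)) (tpow V (r + s)) :=
  tmap (tcatl U r s) (tcatl V r s) (tswap _ _ _ _ (tpure w w')).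

Lemma tcat2_pure U V r s (x : tpow U r) (y : tpow V r) (x' : tpow U s)
    (y' : tpow V s) :
  tcat2 (tpure x y) (tpure x' y') = tpure (tcat x x') (tcat y y').
Proof. by rewrite /tcat2 tswap_pure tmap_pure !tcatl_pure. Qed.

Lemma tcat2_bilin U V r s : bilinear_for *:%R *:%R (@tcat2 U V r s).
Proof. by split=> [w|w] a x y; rewrite /= /tcat2 ?tpurePl ?tpurePr !linearP. Qed.

Lemma tshuf_cat U V r s (x : tpow (tens U V) r) (y : tpow (tens U V) s) :
  tshuf U V (r + s) (tcat x y) = tcat2 (tshuf U V r x) (tshuf U V s y).
Proof.
have tb := bilinDl (tpure_bilin _ _); have tb0 := bilin0l (tpure_bilin _ _).
elim: r x => [|r IH] x.
  have E (w : tens (tpow U s) (tpow V s)) :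
      tcat2 (tpure (tpow1 U) (tpow1 V)) w = w.
    elim/tens_ind: w => [|x1 x2 h1 h2|a b].
    - by rewrite /tcat2 (bilin0r (tpure_bilin _ _)) !linear0.
    - rewrite /tcat2 (bilinDr (tpure_bilin _ _)) !linearD.
      by rewrite -[in RHS]h1 -[in RHS]h2.
    by rewrite tcat2_pure !tcat1.
  rewrite tcat0 linearZ tshuf0 /tcat2 (bilinZl (tpure_bilin _ _)) !linearZ.
  by congr (_ *: _); rewrite -[LHS]E.
elim/tpow_ind: x => [|x1 x2 h1 h2|v x].
- by rewrite (bilin0l (tcat_bilin _ _ _)) !linear0 (bilin0l (tcat2_bilin _ _ _ _)).
- rewrite (bilinDl (tcat_bilin _ _ _)) !linearD.
  by rewrite (bilinDl (tcat2_bilin _ _ _ _)) -h1 -h2.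
rewrite tcatS !tshufS IH.
move: (tshuf U V r x) (tshuf U V s y) => w w'.
elim/tens_ind: v => [|x1 x2 h1 h2|a b].
- by rewrite !tb0 !linear0 (bilin0l (tcat2_bilin _ _ _ _)).
- by rewrite !tb !linearD (bilinDl (tcat2_bilin _ _ _ _)) -h1 -h2.
elim/tens_ind: w => [|x1 x2 h1 h2|a1 b1].
- rewrite (bilin0l (tcat2_bilin _ _ _ _)) !(bilin0r (tpure_bilin _ _)) !linear0.
  by rewrite (bilin0l (tcat2_bilin _ _ _ _)).
- rewrite (bilinDl (tcat2_bilin _ _ _ _)) !(bilinDr (tpure_bilin _ _)) !linearD.
  by rewrite (bilinDl (tcat2_bilin _ _ _ _)) -h1 -h2.
elim/tens_ind: w' => [|x1 x2 h1 h2|a2 b2].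
- by rewrite !(bilin0r (tcat2_bilin _ _ _ _)) (bilin0r (tpure_bilin _ _)) linear0.
- rewrite !(bilinDr (tcat2_bilin _ _ _ _)) (bilinDr (tpure_bilin _ _)) linearD.
  by rewrite -h1 -h2.
by rewrite tcat2_pure !tswap_pure tcat2_pure !tcatS.
Qed.

End ShuffleTheory.
Section MonoidalProduct.
Variable k : fieldType.
Implicit Types A B C H G : cqs k.

Section Product.
Variables A B : cqs k.

Definition cprod_proj n :
    'Hom(tpow (tens (gens A) (gens B)) n, tens (piece A n) (piece B n)) :=
  (tmap (cproj A n) (cproj B n) \o tshuf (gens A) (gens B) n)%VF.

Lemma cprod_surj n : limg (cprod_proj n) = fullv.
Proof.
by rewrite surj_comp ?(tshuf_bij _ _ _).2 // tmap_surj // cproj_surj.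
Qed.

Lemma cprod_inj0 : lker (cprod_proj 0) == 0%VS.
Proof.
by rewrite ker0_comp ?(tshuf_bij _ _ _).1 // tmap_ker0 // cproj0_inj.
Qed.

Lemma cprod_inj1 : lker (cprod_proj 1) == 0%VS.
Proof.
by rewrite ker0_comp ?(tshuf_bij _ _ _).1 // tmap_ker0 // cproj1_inj.
Qed.

(* (a (x) b)(a' (x) b') = aa' (x) bb' *)
Definition cprod_mul r s (w : tens (piece A r) (piece B r))
    (w' : tens (piece A s) (piece B s)) :
    tens (piece A (r + s)) (piece B (r + s)) :=
  tmap (cmul A r s) (cmul B r s) (tswap _ _ _ _ (tpure w w')).

Lemma cprod_mul_bilin r s : bilinear_for *:%R *:%R (@cprod_mul r s).
Proof.
by split=> [w|w] a x y; rewrite /= /cprod_mul ?tpurePl ?tpurePr !linearP.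
Qed.

Lemma cprod_mul_pure r s (a : piece A r) (b : piece B r) (a' : piece A s)
    (b' : piece B s) :
  cprod_mul (tpure a b) (tpure a' b') =
  tpure (cmul A r s (tpure a a')) (cmul B r s (tpure b b')).
Proof. by rewrite /cprod_mul tswap_pure tmap_pure. Qed.

Lemma cprod_proj_tcat r s (x : tpow (tens (gens A) (gens B)) r)
    (y : tpow (tens (gens A) (gens B)) s) :
  cprod_proj (r + s) (tcat x y) = cprod_mul (cprod_proj r x) (cprod_proj s y).
Proof.
rewrite !comp_lfunE tshuf_cat.
move: (tshuf _ _ r x) (tshuf _ _ s y) => w w'.
elim/tens_ind: w => [|x1 x2 h1 h2|a b].
- by rewrite (bilin0l (tcat2_bilin _ _ _ _)) !linear0
    (bilin0l (cprod_mul_bilin _ _)).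
- by rewrite (bilinDl (tcat2_bilin _ _ _ _)) !linearD
    (bilinDl (cprod_mul_bilin _ _)) -h1 -h2.
elim/tens_ind: w' => [|x1 x2 h1 h2|a' b'].
- by rewrite (bilin0r (tcat2_bilin _ _ _ _)) !linear0
    (bilin0r (cprod_mul_bilin _ _)).
- by rewrite (bilinDr (tcat2_bilin _ _ _ _)) !linearD
    (bilinDr (cprod_mul_bilin _ _)) -h1 -h2.
by rewrite tcat2_pure !tmap_pure cprod_mul_pure !cmulE.
Qed.

Lemma cprod_ideal_l r s (x : tpow (tens (gens A) (gens B)) r)
    (y : tpow (tens (gens A) (gens B)) s) :
  cprod_proj s y = 0 -> cprod_proj (r + s) (tcat x y) = 0.
Proof.
by rewrite cprod_proj_tcat => ->; rewrite (bilin0r (cprod_mul_bilin _ _)).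
Qed.

Lemma cprod_ideal_r r s (x : tpow (tens (gens A) (gens B)) r)
    (y : tpow (tens (gens A) (gens B)) s) :
  cprod_proj r x = 0 -> cprod_proj (r + s) (tcat x y) = 0.
Proof.
by rewrite cprod_proj_tcat => ->; rewrite (bilin0l (cprod_mul_bilin _ _)).
Qed.

Definition cprod : cqs k :=
  Cqs cprod_surj cprod_inj0 cprod_inj1 cprod_ideal_l cprod_ideal_r.

Lemma cprod_cmulE r s (w : piece cprod r) (w' : piece cprod s) :
  cmul cprod r s (tpure w w') = cprod_mul w w'.
Proof. by rewrite -(cprojVK w) -(cprojVK w') cmulE; exact: cprod_proj_tcat. Qed.

Lemma cprod_cone : cone cprod = tpure (cone A) (cone B).
Proof.
rewrite /cone /= /cprod_proj comp_lfunE tshuf0 scale1r.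
by rewrite tmap_pure.
Qed.

End Product.

Section Morphisms.

Lemma caid_subproof A :
  is_algmap (X := calg A) (Y := calg A) (fun n => \1%VF).
Proof.
by split=> [|r s]; rewrite ?id_lfunE // tmap_id comp_lfun1l comp_lfun1r.
Qed.

Definition caid A : cahom A A := CaHom (caid_subproof A).

Lemma cacomp_subproof A B C (g : cahom B C) (f : cahom A B) :
  is_algmap (X := calg A) (Y := calg C) (fun n => (g n \o f n)%VF).
Proof.
case: f g => f [f1 fM] [g [g1 gM]] /=; split=> [|r s].
  by rewrite comp_lfunE f1.
by rewrite -comp_lfunA fM comp_lfunA gM -comp_lfunA tmap_comp.
Qed.

Definition cacomp A B C (g : cahom B C) (f : cahom A B) : cahom A C :=
  CaHom (cacomp_subproof g f).

Lemma cahom_eq A B (f g : cahom A B) : (forall n, f n = g n) -> f = g.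
Proof.
case: f g => f pf [g pg] /= fg.
have E : f = g by apply: functional_extensionality_dep.
by case: _ / E pg => pg; congr CaHom; exact: Prop_irrelevance.
Qed.

Lemma caprod_subproof A B A' B' (f : cahom A A') (g : cahom B B') :
  is_algmap (X := calg (cprod A B)) (Y := calg (cprod A' B'))
    (fun n => tmap (f n) (g n)).
Proof.
case: f g => f [f1 fM] [g [g1 gM]] /=; split=> [|r s].
  change (tmap (f 0%N) (g 0%N) (cone (cprod A B)) = cone (cprod A' B')).
  by rewrite !cprod_cone tmap_pure -[cone A']f1 -[cone B']g1.
have fE a a' : f (r + s) (cmul A r s (tpure a a')) =
               cmul A' r s (tpure (f r a) (f s a')).
  by have := congr1 (fun h => fun_of_lfun h (tpure a a')) (fM r s);
    rewrite !comp_lfunE tmap_pure.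
have gE b b' : g (r + s) (cmul B r s (tpure b b')) =
               cmul B' r s (tpure (g r b) (g s b')).
  by have := congr1 (fun h => fun_of_lfun h (tpure b b')) (gM r s);
    rewrite !comp_lfunE tmap_pure.
apply: tens_ext22 => a b a' b'; rewrite !comp_lfunE tmap_pure.
change (tmap (f (r + s)) (g (r + s))
    (cmul (cprod A B) r s (tpure (tpure a b) (tpure a' b'))) =
  cmul (cprod A' B') r s
    (tpure (tmap (f r) (g r) (tpure a b)) (tmap (f s) (g s) (tpure a' b')))).
by rewrite !cprod_cmulE !tmap_pure !cprod_mul_pure tmap_pure fE gE.
Qed.

Definition caprod A B A' B' (f : cahom A A') (g : cahom B B') :
    cahom (cprod A B) (cprod A' B') :=
  CaHom (caprod_subproof f g).

End Morphisms.

(* The conic quantum space generated inside H by a subspace W of H_1. *)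
Section SubSpace.
Variables (H : cqs k) (W : {vspace gens H}).

Definition sub_incl : 'Hom(subvs_of W, gens H) := linfun vsval.

Definition sub_map n : 'Hom(tpow (subvs_of W) n, piece H n) :=
  (cproj H n \o tpmap sub_incl n)%VF.

Definition sub_piece n : vectType k := subvs_of (limg (sub_map n)).

Definition sub_pincl n : 'Hom(sub_piece n, piece H n) := linfun vsval.

Definition sub_proj n : 'Hom(tpow (subvs_of W) n, sub_piece n) :=
  (linfun (vsproj (limg (sub_map n))) \o sub_map n)%VF.

Lemma sub_projE n x : sub_pincl n (sub_proj n x) = sub_map n x.
Proof.
rewrite /sub_pincl [sub_proj n x]comp_lfunE [linfun vsval _]lfunE /=.
rewrite [linfun (vsproj _) _]lfunE /=.
by rewrite vsprojK // memv_img ?memvf.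
Qed.

Lemma sub_proj_eq0 n x : (sub_proj n x == 0) = (sub_map n x == 0).
Proof.
apply/eqP/eqP => h; first by rewrite -sub_projE h linear0.
by apply: val_inj; rewrite /= -[LHS](lfunE vsval) [LHS]sub_projE h.
Qed.

Lemma sub_surj n : limg (sub_proj n) = fullv.
Proof.
apply/eqP; rewrite eqEsubv subvf; apply/subvP => v _.
have /memv_imgP [x _ Ex] : val v \in limg (sub_map n) by exact: subvsP.
suff -> : v = sub_proj n x by rewrite memv_img ?memvf.
by apply: val_inj; rewrite Ex -sub_projE /sub_pincl lfunE.
Qed.

Lemma sub_incl_ker0 : lker sub_incl == 0%VS.
Proof. by apply/lker0P => x y; rewrite !lfunE; exact: val_inj. Qed.

Lemma sub_ker0 n : lker (cproj H n) == 0%VS -> lker (sub_proj n) == 0%VS.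
Proof.
move=> hn; have/lker0P hm : lker (sub_map n) == 0%VS.
  by rewrite ker0_comp // tpmap_ker0 // sub_incl_ker0.
by apply/lker0P => x y h; apply: hm; rewrite -!sub_projE h.
Qed.

Lemma sub_ideal_l r s (x : tpow (subvs_of W) r) (y : tpow (subvs_of W) s) :
  sub_proj s y = 0 -> sub_proj (r + s) (tcat x y) = 0.
Proof.
move=> /eqP; rewrite sub_proj_eq0 => /eqP h; apply/eqP; rewrite sub_proj_eq0.
by rewrite comp_lfunE tpmap_cat cideal_l // -comp_lfunE.
Qed.

Lemma sub_ideal_r r s (x : tpow (subvs_of W) r) (y : tpow (subvs_of W) s) :
  sub_proj r x = 0 -> sub_proj (r + s) (tcat x y) = 0.
Proof.
move=> /eqP; rewrite sub_proj_eq0 => /eqP h; apply/eqP; rewrite sub_proj_eq0.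
by rewrite comp_lfunE tpmap_cat cideal_r // -comp_lfunE.
Qed.

Definition subcqs : cqs k :=
  Cqs sub_surj (sub_ker0 (cproj0_inj H)) (sub_ker0 (cproj1_inj H))
    sub_ideal_l sub_ideal_r.

End SubSpace.
End MonoidalProduct.
Section OmegaObjects.
Variable k : fieldType.
Implicit Types A B C : cqs k.

(* Objects <phi, H> of (frakH(A) |-> frakH(CA o B)). *)
Record comma_obj A B := Comma {
  cobj : cqs k;
  cmap : forall n, 'Hom(piece A n, piece (cprod cobj B) n)
}.

Record comma_hom A B (X Y : comma_obj A B) := CommaHom {
  chom : cahom (cobj X) (cobj Y);
  chomP : forall n, cmap Y n = (tmap (chom n) \1 \o cmap X n)%VF
}.

(* id (x) beta : U (x) V -> U *)
Definition tcontr (U V : vectType k) (beta : dual V) : 'Hom(tens U V, U) :=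
  tlift (fun u v => (beta v : k) *: u).

Section Object.
Variables (A B : cqs k) (X : comma_obj A B).
Local Notation H := (cobj X).

(* phi on generators, as a map A_1 -> H_1 (x) B_1. *)
Definition cmap_gen : 'Hom(gens A, tens (gens H) (gens B)) :=
  (tmap (cgen H)^-1 (cgen B)^-1 \o (cmap X 1 \o cgen A))%VF.

(* b^j (x) a_i |-> h_i^j where phi(a_i) = sum_j h_i^j (x) b_j; basis-free,
   beta (x) a |-> (id (x) beta)(phi a) (cmap_genE). *)
Definition cpi : 'Hom(tens (dual (gens B)) (gens A), gens H) :=
  tlift (fun beta a => tcontr (gens H) beta (cmap_gen a)).

Definition cspan : {vspace gens H} := limg cpi.

Definition csub : cqs k := subcqs cspan.

Definition cpi_sub : 'Hom(tens (dual (gens B)) (gens A), gens csub) :=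
  (linfun (vsproj cspan) \o cpi)%VF.

(* w' is w carried along the surjection induced by cpi (x) id. *)
Definition descends
    (w : cochain2 (tens (tens (dual (gens B)) (gens A)) (gens B)))
    (w' : cochain2 (gens (cprod csub B))) :=
  let p := tmap cpi_sub \1%VF in
  forall r s, (w' r s \o tpmap p (r + s) = tpmap p (r + s) \o w r s)%VF.

(* f is phi corestricted to H^phi o B; it is unique since sub_pincl (x) id is
   injective. *)
Definition in_Omega
    (w : cochain2 (tens (tens (dual (gens B)) (gens A)) (gens B))) :=
  exists w' : cochain2 (gens (cprod csub B)),
    [/\ descends w w', is_Z2 w', admissible w' &
      exists f : forall n, 'Hom(piece A n, piece (cprod csub B) n),
        (forall n, cmap X n = (tmap (sub_pincl cspan n) \1 \o f n)%VF) /\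
        is_algmap (X := calg A) (Y := twist w') f].

Lemma tcontr_pure (U V : vectType k) (beta : dual V) (u : U) (v : V) :
  tcontr U beta (tpure u v) = (beta v : k) *: u.
Proof.
rewrite /tcontr tlift_pure //; split=> [y c x z|y c x z] /=.
  by rewrite scalerDr !scalerA mulrC.
by rewrite linearP scalerDl scalerA.
Qed.

Lemma tcontr_lin (U V : vectType k) (w : tens U V) :
  linear (fun beta : dual V => tcontr U beta w).
Proof.
move=> a x y /=; elim/tens_ind: w => [|w1 w2 h1 h2|u v].
- by rewrite !linear0 addr0.
- by rewrite !raddfD /= h1 h2 addrACA.
by rewrite !tcontr_pure !lfun_simp /= scalerDl scalerA.
Qed.

Lemma cpi_pure beta a :
  cpi (tpure beta a) = tcontr (gens H) beta (cmap_gen a).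
Proof.
rewrite /cpi tlift_pure //; split=> [a' c x y|b' c x y] /=.
  exact: tcontr_lin.
by rewrite !linearP.
Qed.

Lemma cmap_genE n (b : n.-tuple (gens B)) (bd : 'I_n -> dual (gens B)) a :
  basis_of fullv b -> (forall i j : 'I_n, bd i b`_j = (i == j)%:R) ->
  cmap_gen a = \sum_(j < n) tpure (cpi (tpure (bd j) a)) b`_j.
Proof.
move=> bB bdE; rewrite (eq_bigr _ (fun j _ => congr1 (fun u => tpure u _)
  (cpi_pure (bd j) a))).
elim/tens_ind: (cmap_gen a) => [|w1 w2 h1 h2|h v].
- by rewrite big1 // => j _; rewrite linear0 (bilin0l (tpure_bilin _ _)).
- rewrite {1}h1 {1}h2 -big_split; apply: eq_bigr => j _ /=.
  by rewrite linearD (bilinDl (tpure_bilin _ _)).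
rewrite {1}(coord_basis bB (memvf v)) (bilin_sumr (tpure_bilin _ _)).
apply: eq_bigr => j _; rewrite tcontr_pure.
rewrite (bilinZl (tpure_bilin _ _)) (bilinZr (tpure_bilin _ _)); congr (_ *: _).
rewrite [in RHS](coord_basis bB (memvf v)) linear_sum (bigD1 j) //= big1.
  by rewrite addr0 linearZ /= [X in _ *: X]bdE eqxx; exact: (esym (mulr1 _)).
move=> i ne; rewrite linearZ /=. rewrite [X in _ *: X]bdE eq_sym (negbTE ne); exact: mulr0.
Qed.

End Object.

(* <ell_A, K>, with ell_A(a) = e^n (x) a. *)
Definition comma_unit A : comma_obj A A :=
  @Comma A A (cunit k)
    (fun n => linfun (fun a => tpure (1 : k^o) a : piece (cprod (cunit k) A) n)).

Definition comma_prod A C B (X : comma_obj A C) (Y : comma_obj C B) : comma_obj A B :=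
  @Comma A B (cprod (cobj X) (cobj Y))
    (fun n => tassoc _ _ _ \o (tmap \1 (cmap Y n) \o cmap X n))%VF.

End OmegaObjects.
Local Set Primitive Projections.

Record category := Category {
  ob : Type;
  hom_of : ob -> ob -> Type;
  idm : forall x, hom_of x x;
  compm : forall x y z, hom_of y z -> hom_of x y -> hom_of x z;
  compm1l : forall x y (f : hom_of x y), compm (idm y) f = f;
  compm1r : forall x y (f : hom_of x y), compm f (idm x) = f;
  compmA : forall x y z t (h : hom_of z t) (g : hom_of y z) (f : hom_of x y),
    compm h (compm g f) = compm (compm h g) f
}.

Record functor (C D : category) := Functor {
  fob : ob C -> ob D;
  fmap : forall x y, hom_of x y -> hom_of (fob x) (fob y);
  fmap_id : forall x, fmap (idm x) = idm (fob x);
  fmap_comp : forall x y z (g : hom_of y z) (f : hom_of x y),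
    fmap (compm g f) = compm (fmap g) (fmap f)
}.

Local Unset Primitive Projections.

Section CategoryConstructions.

Definition functor_comp (C D E : category) (G : functor D E) (F : functor C D) :
    functor C E :=
  @Functor C E (fun x => fob G (fob F x)) (fun x y f => fmap G (fmap F f))
    (fun x => eq_trans (congr1 _ (fmap_id F x)) (fmap_id G (fob F x)))
    (fun x y z g f => eq_trans (congr1 _ (fmap_comp F g f))
                               (fmap_comp G (fmap F g) (fmap F f))).

Definition prodcat (C D : category) : category :=
  @Category (ob C * ob D)
    (fun x y => hom_of x.1 y.1 * hom_of x.2 y.2)%type
    (fun x => (idm x.1, idm x.2))
    (fun x y z g f => (compm g.1 f.1, compm g.2 f.2))
    (fun x y f => eq_trans (congr2 pair (compm1l f.1) (compm1l f.2))
                           (esym (surjective_pairing f)))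
    (fun x y f => eq_trans (congr2 pair (compm1r f.1) (compm1r f.2))
                           (esym (surjective_pairing f)))
    (fun x y z t h g f =>
       congr2 pair (compmA h.1 g.1 f.1) (compmA h.2 g.2 f.2)).

Definition functor_prod (C D C' D' : category)
    (F : functor C C') (G : functor D D') :
    functor (prodcat C D) (prodcat C' D') :=
  @Functor (prodcat C D) (prodcat C' D')
    (fun x => (fob F x.1, fob G x.2)) (fun x y f => (fmap F f.1, fmap G f.2))
    (fun x => congr2 pair (fmap_id F x.1) (fmap_id G x.2))
    (fun x y z g f =>
       congr2 pair (fmap_comp F g.1 f.1) (fmap_comp G g.2 f.2)).

Definition fullsub (C : category) (P : ob C -> Prop) : category :=
  @Category {x : ob C | P x} (fun x y => hom_of (sval x) (sval y))
    (fun x => idm (sval x))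
    (fun x y z g f => compm g f)
    (fun x y f => compm1l f) (fun x y f => compm1r f)
    (fun x y z t h g f => compmA h g f).

Definition functor_incl (C : category) (P : ob C -> Prop) : functor (fullsub P) C :=
  @Functor (fullsub P) C sval (fun x y f => f)
    (fun x => erefl) (fun x y z g f => erefl).

(* F restricted to the full subcategory of those x with P (F x). *)
Definition functor_restr (C D : category) (F : functor C D) (P : ob D -> Prop) :
    functor (fullsub (fun x => P (fob F x))) (fullsub P) :=
  @Functor (fullsub (fun x => P (fob F x))) (fullsub P)
    (fun x => exist P (fob F (sval x)) (svalP x))
    (fun x y f => fmap F f) (fun x => fmap_id F (sval x))
    (fun x y z g f => fmap_comp F g f).

End CategoryConstructions.

Section ConicCategories.
Variable k : fieldType.
Implicit Types A B C : cqs k.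

Lemma cacomp1l A B (f : cahom A B) : cacomp (caid B) f = f.
Proof. by apply: cahom_eq => n /=; rewrite comp_lfun1l. Qed.

Lemma cacomp1r A B (f : cahom A B) : cacomp f (caid A) = f.
Proof. by apply: cahom_eq => n /=; rewrite comp_lfun1r. Qed.

Lemma cacompA A B C D (h : cahom C D) (g : cahom B C) (f : cahom A B) :
  cacomp h (cacomp g f) = cacomp (cacomp h g) f.
Proof. by apply: cahom_eq => n /=; rewrite comp_lfunA. Qed.

Definition CA : category := Category cacomp1l cacomp1r cacompA.

Lemma caprod_id A B : caprod (caid A) (caid B) = caid (cprod A B).
Proof. by apply: cahom_eq => n /=; rewrite tmap_id. Qed.

Lemma caprod_comp A B C A' B' C' (g : cahom B C) (f : cahom A B)
    (g' : cahom B' C') (f' : cahom A' B') :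
  caprod (cacomp g f) (cacomp g' f') = cacomp (caprod g g') (caprod f f').
Proof. by apply: cahom_eq => n /=; rewrite tmap_comp. Qed.

Definition CA_prod : functor (prodcat CA CA) CA :=
  @Functor (prodcat CA CA) CA (fun x => cprod x.1 x.2)
    (fun x y f => caprod f.1 f.2) (fun x => caprod_id x.1 x.2)
    (fun x y z g f => caprod_comp g.1 f.1 g.2 f.2).

Lemma comma_hom_eq A B (X Y : comma_obj A B) (f g : comma_hom X Y) :
  chom f = chom g -> f = g.
Proof.
case: f g => f pf [g pg] /= E; case: _ / E pg => pg.
by congr CommaHom; exact: Prop_irrelevance.
Qed.

Lemma comma_id_subproof A B (X : comma_obj A B) n :
  cmap X n = (tmap (caid (cobj X) n) \1 \o cmap X n)%VF.
Proof. by rewrite /= tmap_id comp_lfun1l. Qed.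

Lemma comma_comp_subproof A B (X Y Z : comma_obj A B) (g : comma_hom Y Z)
    (f : comma_hom X Y) n :
  cmap Z n = (tmap (cacomp (chom g) (chom f) n) \1 \o cmap X n)%VF.
Proof.
by rewrite (chomP g) (chomP f) comp_lfunA tmap_comp /= comp_lfun1l.
Qed.

Definition comma_id A B (X : comma_obj A B) : comma_hom X X :=
  CommaHom (comma_id_subproof X).

Definition comma_comp A B (X Y Z : comma_obj A B) (g : comma_hom Y Z)
    (f : comma_hom X Y) : comma_hom X Z :=
  CommaHom (comma_comp_subproof g f).

Lemma comma_comp1l A B (X Y : comma_obj A B) (f : comma_hom X Y) :
  comma_comp (comma_id Y) f = f.
Proof. by apply: comma_hom_eq; exact: cacomp1l. Qed.

Lemma comma_comp1r A B (X Y : comma_obj A B) (f : comma_hom X Y) :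
  comma_comp f (comma_id X) = f.
Proof. by apply: comma_hom_eq; exact: cacomp1r. Qed.

Lemma comma_compA A B (X Y Z T : comma_obj A B) (h : comma_hom Z T)
    (g : comma_hom Y Z) (f : comma_hom X Y) :
  comma_comp h (comma_comp g f) = comma_comp (comma_comp h g) f.
Proof. by apply: comma_hom_eq; exact: cacompA. Qed.

(* The comma category (frakH(A) |-> frakH(CA o B)). *)
Definition comma_cat A B : category :=
  Category (@comma_comp1l A B) (@comma_comp1r A B) (@comma_compA A B).

Lemma comma_prod_subproof A C B (X X' : comma_obj A C) (Y Y' : comma_obj C B)
    (f : comma_hom X X') (g : comma_hom Y Y') n :
  cmap (comma_prod X' Y') n =
  (tmap (caprod (chom f) (chom g) n) \1 \o cmap (comma_prod X Y) n)%VF.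
Proof.
rewrite /= (chomP f) (chomP g) !comp_lfunA; congr (_ \o _)%VF.
rewrite -!comp_lfunA tmap_comp comp_lfun1r comp_lfun1l.
apply: tens_ext => h c; rewrite !comp_lfunE !tmap_pure comp_lfunE.
rewrite id_lfunE; elim/tens_ind: (cmap Y n c) => [|w1 w2 h1 h2|u v].
- by rewrite !(linear0, bilin0r (tpure_bilin _ _)).
- by rewrite !(linearD, bilinDr (tpure_bilin _ _)) /= h1 h2.
by rewrite !(tmap_pure, tassoc_pure, id_lfunE).
Qed.

Definition comma_prod_hom A C B (X X' : comma_obj A C) (Y Y' : comma_obj C B)
    (f : comma_hom X X') (g : comma_hom Y Y') :
    comma_hom (comma_prod X Y) (comma_prod X' Y') :=
  @CommaHom k A B (comma_prod X Y) (comma_prod X' Y')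
    (caprod (chom f) (chom g)) (comma_prod_subproof f g).

Lemma comma_prod_id A C B (X : comma_obj A C) (Y : comma_obj C B) :
  comma_prod_hom (comma_id X) (comma_id Y) = comma_id (comma_prod X Y).
Proof. by apply: comma_hom_eq; exact: caprod_id. Qed.

Lemma comma_prod_comp A C B (X Y Z : comma_obj A C) (X' Y' Z' : comma_obj C B)
    (g : comma_hom Y Z) (f : comma_hom X Y)
    (g' : comma_hom Y' Z') (f' : comma_hom X' Y') :
  comma_prod_hom (comma_comp g f) (comma_comp g' f') =
  comma_comp (comma_prod_hom g g') (comma_prod_hom f f').
Proof. by apply: comma_hom_eq; exact: caprod_comp. Qed.

(* The partial product of frakH CA, on the component
   (frakH(A) |-> frakH(CA o C)) x (frakH(C) |-> frakH(CA o B)). *)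
Definition comma_prodF A C B :
    functor (prodcat (comma_cat A C) (comma_cat C B)) (comma_cat A B) :=
  @Functor (prodcat (comma_cat A C) (comma_cat C B)) (comma_cat A B)
    (fun X => comma_prod X.1 X.2) (fun X Y f => comma_prod_hom f.1 f.2)
    (fun X => comma_prod_id X.1 X.2)
    (fun X Y Z g f => comma_prod_comp g.1 f.1 g.2 f.2).

Definition comma_forget A B : functor (comma_cat A B) CA :=
  @Functor (comma_cat A B) CA (@cobj k A B) (@chom k A B)
    (fun _ => erefl) (fun _ _ _ _ _ => erefl).

(* The disjoint union of the categories Omega^{A,B} is handled through its
   components: a functor out of it, such as P_Omega or prod_Omega, is a family
   of functors. *)
Definition cochain_family := forall A B,
  cochain2 (tens (tens (dual (gens B)) (gens A)) (gens B)).

Variable w : cochain_family.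

Definition Omega A B : category :=
  fullsub (C := comma_cat A B) (fun X => in_Omega X (w A B)).

Definition P_Omega A B : functor (Omega A B) CA :=
  functor_comp (comma_forget A B) (functor_incl _).

Definition comma_prod_Omega A C B :
    functor (prodcat (Omega A C) (Omega C B)) (comma_cat A B) :=
  functor_comp (comma_prodF A C B) (functor_prod (functor_incl _) (functor_incl _)).

(* The domain of o_Omega in Omega^{A,C} x Omega^{C,B}: the restriction of a
   partial product to a subcategory is defined where the product stays in it. *)
Definition prod_Omega_dom A C B : category :=
  fullsub (fun XY => in_Omega (fob (comma_prod_Omega A C B) XY) (w A B)).

Definition prod_Omega A C B : functor (prod_Omega_dom A C B) (Omega A B) :=
  functor_restr (comma_prod_Omega A C B) (fun X => in_Omega X (w A B)).

End ConicCategories.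

Definition factorized (k : fieldType)
    (psi : forall A : cqs k, cochain2 (gens A)) : cochain_family k :=
  fun A B => join_cochain (dual_cochain (psi B)) (psi A) (@id_cochain k (gens B)).

(* Main.v *)
(** Over a factorizable collection, omega_{A,B} acts on U^(x)n (x) B_1^(x)n, with
    U = B_1^* (x) A_1, as sigma_{A,B} (x) id, where
    sigma_{A,B} = psi_B^! (x) psi_A. Hence <phi, H> lies in Omega^{A,B} iff phi is
    unital, sigma_{A,B} descends along pi^phi, and there are T_{r,s} on
    H_r (x) H_s, compatible with sigma_{A,B} whenever B_r (x) B_s <> 0, such that
    phi(a a') = (m_H (x) m_B)(T (x) id)(phi a (x) phi a') up to the middle swap.

    For a product over C, the map pi of the product factors through
    pi^phi (x) pi^chi after inserting the canonical element of C_1^* (x) C_1.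
    The corresponding canonical element in tensor degree n is fixed by
    psi_C^! (x) psi_C, so the insertion intertwines sigma_{A,B} with
    sigma_{A,C} (x) sigma_{C,B}, and T_X (x) T_Y serves for the product. For the
    unit, pi is the evaluation pairing, which psi_A^! (x) psi_A preserves, and
    T = id. *)

Require Import Defs.
From mathcomp Require Import all_boot all_algebra boolp.

Set Implicit Arguments.
Unset Strict Implicit.
Unset Printing Implicit Defensive.

Import GRing.Theory.
Local Open Scope ring_scope.

(** * Tensor powers *)

Section Tensors.
Variable k : fieldType.
Implicit Types U V W Z : vectType k.

(** [f^-1] is only a generalized inverse: [f^-1 (f x)] and [x] differ by an element of the kernel of
    [f], which [g] kills. With [g = f \o w] this yields the operator induced by [w] along [f]
    whenever [w] preserves that kernel. *)
Lemma lfun_descend U V W (f : 'Hom(U, V)) (g : 'Hom(U, W)) :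
  (forall x, f x = 0 -> g x = 0) -> (g \o f^-1 \o f)%VF = g.
Proof.
move=> fg; apply/lfunP => x; apply/eqP; rewrite -subr_eq0.
rewrite !comp_lfunE -linearB /=; apply/eqP/fg; rewrite linearB /=.
have := congr1 (fun h => fun_of_lfun h x) (inv_lfun_def f).
by rewrite !comp_lfunE => ->; rewrite subrr.
Qed.

Lemma lfun_comp_eq U V V' W (f : 'Hom(V, W)) (g : 'Hom(U, V)) (f' : 'Hom(V', W))
    (g' : 'Hom(U, V')) :
  (f \o g = f' \o g')%VF -> forall x, f (g x) = f' (g' x).
Proof. by move=> E x; rewrite -comp_lfunE E comp_lfunE. Qed.

Lemma lfun_surjP U V (f : 'Hom(U, V)) (v : V) :
  limg f = fullv -> exists u, v = f u.
Proof.
move=> fs; have /memv_imgP [u _ ->] : v \in limg f by rewrite fs memvf.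
by exists u.
Qed.

Lemma id_ker0 V : lker (\1%VF : 'End(V)) == 0%VS.
Proof. by apply/lker0P => x y; rewrite !id_lfunE. Qed.

Lemma tpure0l U V (v : V) : tpure (0 : U) v = 0.
Proof. exact: bilin0l (tpure_bilin _ _) _. Qed.

Lemma tpure0r U V (u : U) : tpure u (0 : V) = 0.
Proof. exact: bilin0r (tpure_bilin _ _) _. Qed.

Lemma tpureDl U V (u u' : U) (v : V) :
  tpure (u + u') v = tpure u v + tpure u' v.
Proof. exact: bilinDl (tpure_bilin _ _) _ _ _. Qed.

Lemma tpureDr U V (u : U) (v v' : V) :
  tpure u (v + v') = tpure u v + tpure u v'.
Proof. exact: bilinDr (tpure_bilin _ _) _ _ _. Qed.

Lemma tpureZl U V a (u : U) (v : V) : tpure (a *: u) v = a *: tpure u v.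
Proof. exact: bilinZl (tpure_bilin _ _) _ _ _. Qed.

Lemma tpureZr U V a (u : U) (v : V) : tpure u (a *: v) = a *: tpure u v.
Proof. exact: bilinZr (tpure_bilin _ _) _ _ _. Qed.

Lemma dcoord_eq0 U (u : U) : (forall i, dcoord i u = 0) -> u = 0.
Proof.
move=> u0; rewrite (coord_vbasis (memvf u)) big1 // => i _.
by rewrite -dcoordE u0 scale0r.
Qed.

Lemma tpure_eq0 U V (u : U) (v : V) : tpure u v = 0 -> v != 0 -> u = 0.
Proof.
move=> uv v0; apply: dcoord_eq0 => i; have := tpureE u v (dcoord i).
by rewrite uv zero_lfunE => /esym/eqP; rewrite scaler_eq0 (negbTE v0) orbF =>
  /eqP.
Qed.

(** Where [g] is zero both composites vanish, so the relation between [s] and [t] matters only for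
    nonzero [g]. The nonvanishing guards on [T] below have this shape. *)
Lemma tmap_intertwine U U' V V' (f : 'Hom(U, U')) (g : 'Hom(V, V'))
    (s : 'End(U)) (t : 'End(U')) :
  ((exists v, g v != 0) -> (t \o f = f \o s)%VF) ->
  (tmap t \1 \o tmap f g = tmap f g \o tmap s \1)%VF.
Proof.
move=> tf; apply: tens_ext => u v; rewrite !comp_lfunE !tmap_pure !id_lfunE.
have [->|v0] := eqVneq (g v) 0; first by rewrite !tpure0r.
by rewrite -!comp_lfunE tf //; exists v.
Qed.

Lemma tswapKE U V U' V' : cancel (tswap U V U' V') (tswap U U' V V').
Proof. by move=> x; rewrite -comp_lfunE tswapK id_lfunE. Qed.

(** Deconcatenation, the two-sided inverse of [tcatl]; it shows that the products [tcat x y] span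
    each tensor power. *)
Fixpoint tuncat V r s : 'Hom(tpow V (r + s), tens (tpow V r) (tpow V s)) :=
  match r return 'Hom(tpow V (r + s), tens (tpow V r) (tpow V s)) with
  | 0 => linfun (tpure (tpow1 V))
  | r'.+1 => (tassoc _ _ _ \o tmap \1 (tuncat V r' s))%VF
  end.

Lemma tcatlK V r s :
  (tuncat V r s \o tcatl V r s)%VF = \1%VF /\
  (tcatl V r s \o tuncat V r s)%VF = \1%VF.
Proof.
elim: r => [|r [IH1 IH2]].
  have E y : tuncat V 0 s y = tpure (tpow1 V) y.
    by apply: linfunE => a u v; rewrite tpurePr.
  split.
    apply: tens_ext => a y; rewrite !comp_lfunE tcatl_pure tcat0 E tpureZr.
    rewrite id_lfunE -tpureZl; congr (tpure _ _); exact: mulr1.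
  by apply/lfunP => y; rewrite comp_lfunE E tcatl_pure tcat1 id_lfunE.
have E v y : tuncat V r.+1 s (tpure v y : tpow V (r + s).+1) =
    tassoc _ _ _ (tpure v (tuncat V r s y)).
  by rewrite [LHS]comp_lfunE tmap_pure id_lfunE.
have F v w : tcatl V r.+1 s (tassoc _ _ _ (tpure v w)) =
    tpure v (tcatl V r s w).
  elim/tens_ind: w => [|x y hx hy|x y].
  - by rewrite linear0 tpure0r !linear0 tpure0r.
  - by rewrite linearD !tpureDr !linearD /= hx hy.
  by rewrite tassoc_pure !tcatl_pure tcatS.
split.
  apply: tens_ext => w y; rewrite comp_lfunE id_lfunE.
  elim/tpow_ind: w => [|w1 w2 h1 h2|v x].
  - by rewrite tpure0l !linear0.
  - by rewrite tpureDl !linearD /= h1 h2.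
  rewrite tcatl_pure tcatS E -tcatl_pure -comp_lfunE IH1 id_lfunE.
  exact: tassoc_pure.
apply: tpow_ext => v x.
by rewrite comp_lfunE E F -comp_lfunE IH2 !id_lfunE.
Qed.

Lemma tcatl_ker0 V r s : lker (tcatl V r s) == 0%VS.
Proof. exact: lfun_cancel_ker0 (tcatlK V r s).1. Qed.

Lemma tcatl_surj V r s : limg (tcatl V r s) = fullv.
Proof. exact: lfun_cancel_surj (tcatlK V r s).2. Qed.

Lemma tcat_ext V W r s (f g : 'Hom(tpow V (r + s), W)) :
  (forall x y, f (tcat x y) = g (tcat x y)) -> f = g.
Proof.
move=> fg; apply/lfunP => w; have [z ->] := lfun_surjP w (tcatl_surj V r s).
rewrite -!comp_lfunE; congr (fun_of_lfun _ z); apply: tens_ext => x y.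
by rewrite !comp_lfunE tcatl_pure.
Qed.

(** Test vectors whose first block already lies in the image of [p]. For [p = psi r s] they have
    exactly the shape of one side of the cocycle identity. *)
Lemma tcat_ext_surj V W r s t (p : 'End(tpow V (r + s)))
    (f g : 'Hom(tpow V (r + s + t), W)) : limg p = fullv ->
  (forall x y z, f (tcat (p (tcat x y)) z) = g (tcat (p (tcat x y)) z)) ->
  f = g.
Proof.
move=> ps fg; apply: tcat_ext => u z.
have [u1 ->] := lfun_surjP u ps.
have [w ->] := lfun_surjP u1 (tcatl_surj V r s).
elim/tens_ind: w => [|w1 w2 h1 h2|x y]; last by rewrite tcatl_pure fg.
  by rewrite !linear0 (bilin0l (tcat_bilin _ _ _)) !linear0.
by rewrite !linearD (bilinDl (tcat_bilin _ _ _)) !linearD /= h1 h2.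
Qed.

Lemma tpmap_surj U V (f : 'Hom(U, V)) n :
  limg f = fullv -> limg (tpmap f n) = fullv.
Proof.
move=> fs; apply: (@lfun_cancel_surj _ _ _ _ (tpmap f^-1 n)).
by rewrite tpmap_comp surj_compfV // tpmap_id.
Qed.

Lemma tshuf_ker0 U V n : lker (tshuf U V n) == 0%VS.
Proof. exact: (tshuf_bij U V n).1. Qed.

Lemma tshuf_surj U V n : limg (tshuf U V n) = fullv.
Proof. exact: (tshuf_bij U V n).2. Qed.

Lemma tshufVK U V n : cancel (tshuf U V n)^-1%VF (tshuf U V n).
Proof. by move=> x; rewrite limg_lfunVK // tshuf_surj memvf. Qed.

Lemma tshuf_tpmap U V U' V' (f : 'Hom(U, U')) (g : 'Hom(V, V')) n :
  (tshuf U' V' n \o tpmap (tmap f g) n =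
   tmap (tpmap f n) (tpmap g n) \o tshuf U V n)%VF.
Proof.
elim: n => [|n IH].
  apply/lfunP => c; rewrite !comp_lfunE tpmap0 !tshuf0 linearZ /= tmap_pure.
  by rewrite !id_lfunE.
apply: tpow_ext => w x; rewrite comp_lfunE [RHS]comp_lfunE tpmapS !tshufS.
rewrite -[tshuf U' V' n _]comp_lfunE IH comp_lfunE.
move: (tshuf U V n x) => y; elim/tens_ind: w => [|w w' h h'|u v].
- by rewrite linear0 !tpure0l !linear0.
- by rewrite linearD !tpureDl !linearD /= h h'.
elim/tens_ind: y => [|w w' h h'|a b].
- by rewrite linear0 !tpure0r !linear0.
- by rewrite linearD !tpureDr !linearD /= h h'.
by rewrite !tmap_pure !tswap_pure !tmap_pure.
Qed.

End Tensors.

(** * Cocycles and their images *)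

Section Casts.
Variable k : fieldType.
Implicit Types U V W : vectType k.

Lemma ecast0 (F : nat -> vectType k) m n (e : m = n) :
  ecast n (F n) e (0 : F m) = 0.
Proof. by case: n / e. Qed.

Lemma ecastD (F : nat -> vectType k) m n (e : m = n) (x y : F m) :
  ecast n (F n) e (x + y) = ecast n (F n) e x + ecast n (F n) e y.
Proof. by case: n / e. Qed.

Lemma ecast_lfun (F G : nat -> vectType k) (f : forall n, 'Hom(F n, G n)) m n
    (e : m = n) (x : F m) :
  f n (ecast n (F n) e x) = ecast n (G n) e (f m x).
Proof. by case: n / e. Qed.

Lemma ecast_tpure U V m n (e : m = n) (x : tpow U m) (y : tpow V m) :
  ecast n (tens (tpow U n) (tpow V n)) e (tpure x y) =
  tpure (ecast n (tpow U n) e x) (ecast n (tpow V n) e y).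
Proof. by case: n / e. Qed.

Lemma ecast_tpureS U m n (e1 : m.+1 = n.+1) (e2 : m = n) (u : U)
    (x : tpow U m) :
  ecast i (tpow U i) e1 (tpure u x : tpow U m.+1) =
  tpure u (ecast i (tpow U i) e2 x).
Proof. by case: n / e2 e1 => e1; rewrite eq_axiomK. Qed.

End Casts.

(** * Descent and tensor products of counital 2-cocycles *)

Section Cocycles.
Variable k : fieldType.
Implicit Types U V W : vectType k.

(** Arguments in tensor powers of [V] lift along the surjections [tpmap p], which respect
    concatenation, so the counit and cocycle identities are inherited. Injectivity is not inherited
    this way and comes from a dimension count. *)
Lemma descend_Z2 U V (p : 'Hom(U, V)) (w : cochain2 U) (w' : cochain2 V) :
  limg p = fullv ->
  (forall r s, (w' r s \o tpmap p (r + s) = tpmap p (r + s) \o w r s)%VF) ->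
  is_Z2 w -> is_Z2 w'.
Proof.
move=> ps wE [w2 [w0s wr0] wc].
have ws r s : limg (w r s) = fullv by apply: lker0_limgf; apply: w2.
have wE' r s x : w' r s (tpmap p (r + s) x) = tpmap p (r + s) (w r s x).
  by rewrite -!comp_lfunE wE.
have pS n := tpmap_surj n ps.
split=> [r s||r s t x y z].
- have w's : limg (w' r s) = fullv.
    apply/eqP; rewrite eqEsubv subvf; apply/subvP => x _.
    have [z ->] := lfun_surjP x (pS (r + s)%N).
    have [z' ->] := lfun_surjP z (ws r s).
    by rewrite -wE' memv_img ?memvf.
  (* Rank-nullity: a surjective endomorphism in finite dimension has zero kernel. *)
  have := limg_ker_dim (w' r s) fullv; rewrite capfv w's => /eqP.
  rewrite -[X in _ == X]add0n eqn_add2r dimv_eq0; apply.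
- split=> [s|r]; apply/lfunP => x; have [z ->] := lfun_surjP x (pS _).
    by rewrite wE' w0s !id_lfunE.
  by rewrite wE' wr0 !id_lfunE.
have [x' ->] := lfun_surjP x (pS _).
have [y' ->] := lfun_surjP y (pS _).
have [z' ->] := lfun_surjP z (pS _).
rewrite -!tpmap_cat !wE' -!tpmap_cat !wE' -wc.
by rewrite (@ecast_lfun k _ _ (tpmap p)).
Qed.

(** Two-factor form of [join_cochain]. Iterating it ([join_cochainE]) separates the identity cochain
    on [gens B] from the factor that carries the twisting. *)
Definition join2 U V (a : cochain2 U) (b : cochain2 V) : cochain2 (tens U V) :=
  fun r s => ((tshuf U V (r + s))^-1 \o
    (tmap (a r s) (b r s) \o tshuf U V (r + s)))%VF.

Lemma join2E U V (a : cochain2 U) (b : cochain2 V) r s x :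
  tshuf U V (r + s) (join2 a b r s x) =
  tmap (a r s) (b r s) (tshuf U V (r + s) x).
Proof. by rewrite 2!comp_lfunE tshufVK. Qed.

(** The injective shuffle turns concatenation into the factorwise product [tcat2]; on pure tensors
    the identity then splits into those of [a] and [b]. *)
Lemma join2_Z2 U V (a : cochain2 U) (b : cochain2 V) :
  is_Z2 a -> is_Z2 b -> is_Z2 (join2 a b).
Proof.
move=> [a2 [a0s ar0] ac] [b2 [b0s br0] bc].
have SI n := elimT lker0P (tshuf_ker0 U V n).
split=> [r s||r s t x y z].
- apply/lker0P => x y /(congr1 (tshuf U V _)); rewrite !join2E => h.
  exact: SI (elimT lker0P (tmap_ker0 (a2 r s) (b2 r s)) _ _ h).
- split=> [s|r]; apply/lfunP => x; apply: SI; rewrite join2E id_lfunE.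
    by rewrite a0s b0s tmap_id id_lfunE.
  by rewrite ar0 br0 tmap_id id_lfunE.
apply: SI; rewrite (@ecast_lfun k _ _ (tshuf U V)).
rewrite !join2E !tshuf_cat !join2E !tshuf_cat.
move: (tshuf U V r x) (tshuf U V s y) (tshuf U V t z) => {x y z} x y z.
have tl := bilin0l (tcat2_bilin _ _ _ _).
have tr := bilin0r (tcat2_bilin _ _ _ _).
have Dl := bilinDl (tcat2_bilin _ _ _ _).
have Dr := bilinDr (tcat2_bilin _ _ _ _).
pose F n := tens (tpow U n) (tpow V n).
elim/tens_ind: x => [|x x' h h'|x1 x2].
- by rewrite !(tl, linear0) (@ecast0 k F).
- by rewrite !(Dl, linearD) /= (@ecastD k F) h h'.
elim/tens_ind: y => [|y y' h h'|y1 y2].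
- by rewrite !(tl, tr, linear0) (@ecast0 k F).
- by rewrite !(Dl, Dr, linearD) /= (@ecastD k F) h h'.
elim/tens_ind: z => [|z z' h h'|z1 z2].
- by rewrite !(tl, tr, linear0) (@ecast0 k F).
- by rewrite !(Dl, Dr, linearD) /= (@ecastD k F) h h'.
by rewrite !(tcat2_pure, tmap_pure) ecast_tpure ac bc.
Qed.

(** The cocycle identity here is associativity of concatenation, up to the cast. *)
Lemma id_cochain_Z2 U : is_Z2 (@id_cochain k U).
Proof.
split=> // [r s|r s t x y z]; first exact: id_ker0.
rewrite !id_lfunE.
elim: r x => [|r IH] x.
  rewrite tcat0 tcat0.
  have := bilinZl (tcat_bilin U s t) (x : k^o) y z => ->.
  by rewrite eq_axiomK.
elim/tpow_ind: x => [|x x' h h'|v x].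
- by rewrite !(bilin0l (tcat_bilin _ _ _)) (@ecast0 k (tpow U)).
- by rewrite !(bilinDl (tcat_bilin _ _ _)) (@ecastD k (tpow U)) h h'.
rewrite !tcatS -IH; exact: ecast_tpureS.
Qed.

Lemma join_cochainE U V W (a : cochain2 U) (b : cochain2 V) (c : cochain2 W) :
  join_cochain a b c = join2 (join2 a b) c.
Proof.
apply: functional_extensionality_dep => r.
apply: functional_extensionality_dep => s.
have S3 n : lker (tshuf3 U V W n) == 0%VS.
  by rewrite ker0_comp ?tshuf_ker0 // tmap_ker0 ?tshuf_ker0 ?id_ker0.
have S3s n : limg (tshuf3 U V W n) = fullv.
  by rewrite surj_comp ?tshuf_surj // tmap_surj ?tshuf_surj ?lim1g.
apply/lfunP => x; apply: (elimT lker0P (S3 _)).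
rewrite [join_cochain _ _ _ _ _ _]comp_lfunE limg_lfunVK ?S3s ?memvf //.
have S3E n z : tshuf3 U V W n z = tmap (tshuf U V n) \1 (tshuf _ _ n z).
  exact: comp_lfunE.
rewrite comp_lfunE !S3E join2E; apply: lfun_comp_eq.
rewrite !tmap_comp comp_lfun1l comp_lfun1r; congr (tmap _ _).
by apply/lfunP => y; rewrite [RHS]comp_lfunE join2E comp_lfunE.
Qed.

End Cocycles.

(** * The dual cocycle *)

Section Duals.
Variable k : fieldType.
Implicit Types U V W : vectType k.

Lemma dual_coordE U (xi : dual U) :
  xi = \sum_(i < \dim {:U}) (xi (vbasis {:U})`_i : k) *: dcoord i.
Proof.
apply/lfunP => u; rewrite sum_lfunE {1}(coord_vbasis (memvf u)) linear_sum.
apply: eq_bigr => i _; rewrite scale_lfunE linearZ dcoordE; exact: mulrC.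
Qed.

Lemma dtens_pure U V (xi : dual U) (eta : dual V) u v :
  dtens U V (tpure xi eta) (tpure u v) = (xi u : k) *: eta v.
Proof.
have b (xi' : dual U) (eta' : dual V) :
    bilinear_for *:%R *:%R (fun (u : U) (v : V) => (xi' u : k) *: eta' v).
  split=> [y a x z|y a x z] /=; first by rewrite linearP scalerDl scalerA.
  by rewrite linearP scalerDr !scalerA mulrC.
rewrite /dtens !tlift_pure //.
split=> [y|y] a x z /=; apply: tens_ext => u' v';
  rewrite !lfun_simp !tlift_pure //.
  by rewrite !lfun_simp scalerDl scalerA.
by rewrite !lfun_simp scalerDr !scalerA mulrC.
Qed.

(** In finite dimension a form on [tens U V] is determined by its values on basis tensors; [g]
    rebuilds the tensor of functionals from these values. *)
Lemma dtens_ker0 U V : lker (dtens U V) == 0%VS.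
Proof.
pose g (z : dual (tens U V)) : tens (dual U) (dual V) :=
  \sum_(i < \dim {:U}) \sum_(j < \dim {:V})
    (z (tpure (vbasis {:U})`_i (vbasis {:V})`_j) : k) *:
      tpure (dcoord i) (dcoord j).
have gl : linear g.
  move=> a x y; rewrite scaler_sumr -big_split; apply: eq_bigr => i _ /=.
  rewrite scaler_sumr -big_split; apply: eq_bigr => j _ /=.
  by rewrite !lfun_simp scalerDl scalerA.
apply: (@lfun_cancel_ker0 _ _ _ _ (linfun g)); apply: tens_ext => xi eta.
rewrite comp_lfunE id_lfunE linfunE // /g.
rewrite [in RHS](dual_coordE xi) (bilin_suml (tpure_bilin _ _)).
apply: eq_bigr => i _.
rewrite [in RHS](dual_coordE eta) (bilin_sumr (tpure_bilin _ _)).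
apply: eq_bigr => j _.
by rewrite dtens_pure tpureZl tpureZr scalerA.
Qed.

Lemma dtens_surj U V : limg (dtens U V) = fullv.
Proof.
apply/eqP; rewrite eqEsubv subvf; apply/subvP => z _.
have -> : z = dtens U V (\sum_(i < \dim {:U}) \sum_(j < \dim {:V})
    (z (tpure (vbasis {:U})`_i (vbasis {:V})`_j) : k) *:
      tpure (dcoord i) (dcoord j)).
  apply: tens_ext => u v; rewrite linear_sum sum_lfunE.
  rewrite [in LHS](coord_vbasis (memvf u)) (bilin_suml (tpure_bilin _ _)).
  rewrite linear_sum; apply: eq_bigr => i _ /=; rewrite linear_sum sum_lfunE /=.
  rewrite [in LHS](coord_vbasis (memvf v)) (bilin_sumr (tpure_bilin _ _)).
  rewrite linear_sum; apply: eq_bigr => j _ /=.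
  rewrite tpureZl tpureZr scalerA !linearZ /= scale_lfunE dtens_pure !dcoordE.
  exact: mulrC.
by rewrite memv_img ?memvf.
Qed.

Lemma tdual0 V (a : tpow (dual V) 0) (c : tpow V 0) :
  tdual V 0 a c = (a : k) *: (c : k^o).
Proof.
rewrite /= (linfunE (f := fun c : k^o => (c : k) *: (\1%VF : dual k^o))).
  by rewrite scale_lfunE id_lfunE.
by move=> b x y; rewrite scalerDl scalerA.
Qed.

Lemma tdualS V n (xi : dual V) (eta : tpow (dual V) n) v (x : tpow V n) :
  tdual V n.+1 (tpure xi eta : tpow (dual V) n.+1) (tpure v x : tpow V n.+1) =
  (xi v : k) *: tdual V n eta x.
Proof. by rewrite [tdual V n.+1 _]comp_lfunE tmap_pure id_lfunE dtens_pure. Qed.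

Lemma tdual_bij V n : lker (tdual V n) == 0%VS /\ limg (tdual V n) = fullv.
Proof.
elim: n => [|n [IH1 IH2]]; last first.
  split; first by rewrite ker0_comp ?dtens_ker0 // tmap_ker0 ?id_ker0.
  by rewrite surj_comp ?dtens_surj // tmap_surj ?lim1g.
have E c : tdual V 0 c = (c : k) *: (\1%VF : dual k^o).
  by apply/lfunP => a; rewrite tdual0 scale_lfunE id_lfunE.
split.
  apply/lker0P => a b /(congr1 (fun f : dual k^o => f (1 : k^o))).
  by rewrite !tdual0 /GRing.scale /= !mulr1.
apply/eqP; rewrite eqEsubv subvf; apply/subvP => z _.
have -> : z = tdual V 0 (z (1 : k^o) : tpow (dual V) 0).
  apply/lfunP => c; rewrite tdual0 /= -[c in LHS]mulr1.
  by rewrite -[c * 1]/((c : k) *: (1 : k^o)) linearZ; exact: mulrC.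
by rewrite memv_img ?memvf.
Qed.

Lemma tdual_inj V n (xi eta : tpow (dual V) n) :
  (forall x, tdual V n xi x = tdual V n eta x) -> xi = eta.
Proof. by move=> h; apply: (elimT lker0P (tdual_bij V n).1); apply/lfunP. Qed.

(** [tdual] keeps the order of factors, so each block is paired with the block in the same
    position. *)
Lemma tdual_cat V r s (xi : tpow (dual V) r) (eta : tpow (dual V) s)
    (x : tpow V r) (y : tpow V s) :
  tdual V (r + s) (tcat xi eta) (tcat x y) =
  (tdual V r xi x : k) *: tdual V s eta y.
Proof.
elim: r xi x => [|r IH] xi x.
rewrite !tcat0 tdual0 !linearZ /= scale_lfunE.
  by rewrite [LHS]scalerA [x * _]mulrC.
elim/tpow_ind: xi => [|xi xi' h h'|xi1 xi].
- by rewrite (bilin0l (tcat_bilin _ _ _)) !linear0 !zero_lfunE scale0r.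
- rewrite (bilinDl (tcat_bilin _ _ _)) !linearD /= !add_lfunE scalerDl.
  by rewrite -h -h'.
elim/tpow_ind: x => [|x x' h h'|v x].
- by rewrite (bilin0l (tcat_bilin _ _ _)) !linear0 scale0r.
- rewrite (bilinDl (tcat_bilin _ _ _)) !linearD scalerDl.
  by rewrite -h -h'.
by rewrite !tcatS !tdualS IH scalerA.
Qed.

Lemma transpE U V (f : 'Hom(U, V)) xi u : transp f xi u = xi (f u).
Proof.
rewrite /transp (linfunE (f := fun xi : dual V => (xi \o f)%VF : dual U)).
  exact: comp_lfunE.
by move=> a x y; apply/lfunP => z; rewrite !lfun_simp.
Qed.

Lemma transp_surj U V (f : 'Hom(U, V)) :
  lker f == 0%VS -> limg (transp f) = fullv.
Proof.
move=> f0; apply: (@lfun_cancel_surj _ _ _ _ (transp f^-1)).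
apply/lfunP => xi; apply/lfunP => u.
by rewrite comp_lfunE !transpE lker0_lfunK // id_lfunE.
Qed.

(** Invariance of the pairing characterizes the inverse transpose; all later arguments about
    [dual_cochain] rest on this rather than on its formula with inverses. *)
Lemma dual_cochainE V (psi : cochain2 V) r s xi x : is_C2 psi ->
  tdual V (r + s) (dual_cochain psi r s xi) (psi r s x) = tdual V (r + s) xi x.
Proof.
move=> p2; rewrite [dual_cochain _ _ _ _]comp_lfunE.
rewrite limg_lfunVK ?(tdual_bij _ _).2 ?memvf // comp_lfunE -transpE.
by rewrite limg_lfunVK // transp_surj ?memvf.
Qed.

(** The pairing separates points, so each identity is tested against vectors in the image of [psi],
    where [dual_cochainE] cancels [psi] against its inverse transpose. *)
Lemma dual_cochain_Z2 V (psi : cochain2 V) :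
  is_Z2 psi -> is_Z2 (dual_cochain psi).
Proof.
move=> [p2 [p0s pr0] pc].
have pE r s xi x := @dual_cochainE V psi r s xi x p2.
have ps r s : limg (psi r s) = fullv by apply: lker0_limgf; apply: p2.
split=> [r s||r s t xi eta zeta].
- apply/lker0P => xi eta h; apply: tdual_inj => x.
  by rewrite -pE h pE.
- split=> [s|r]; apply/lfunP => xi; apply: tdual_inj => x; rewrite id_lfunE.
    by have := pE 0%N s xi x; rewrite p0s id_lfunE.
  by have := pE r 0%N xi x; rewrite pr0 id_lfunE.
apply: tdual_inj => z.
have [z' ->] := lfun_surjP z (ps _ _).
rewrite pE; have castE m n (e : m = n) (q : tpow (dual V) m) (q' : tpow V m) :
    tdual V n (ecast n (tpow (dual V) n) e q) (ecast n (tpow V n) e q') =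
    tdual V m q q' by case: n / e.
set a := ecast _ _ _ _; set b := tcat _ _.
rewrite -comp_lfunE; congr (fun_of_lfun _ z').
(* The cocycle identity of [psi] rewrites the test vector into the bracketing that matches [a], so
   that the two casts cancel. *)
apply: (tcat_ext_surj (ps r s)) => x y w; rewrite comp_lfunE -pc castE pE.
by rewrite /b !tdual_cat !pE !tdual_cat scalerA.
Qed.

End Duals.

(** * Coevaluation *)

Section Coevaluation.
Variable k : fieldType.
Implicit Types U V W X Y : vectType k.

(** Contraction of the first factor with [y]. The map [D] is a parameter because [X] will be a
    tensor power of the dual, identified with a dual space only through [tdual]. *)
Definition tev X Y W (D : 'Hom(X, dual Y)) (y : Y) : 'Hom(tens X W, W) :=
  tlift (fun xi w => (D xi y : k) *: w).

Lemma tev_pure X Y W (D : 'Hom(X, dual Y)) y xi (w : W) :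
  tev W D y (tpure xi w) = (D xi y : k) *: w.
Proof.
rewrite /tev tlift_pure //; split=> [v a x z|v a x z] /=.
  by rewrite linearP lfun_simp lfun_simp scalerDl scalerA.
by rewrite scalerDr !scalerA mulrC.
Qed.

Lemma tev_inj X Y W (D : 'Hom(X, dual Y)) (M N : tens X W) :
  lker D == 0%VS -> limg D = fullv ->
  (forall y, tev W D y M = tev W D y N) -> M = N.
Proof.
move=> D0 Ds; suff h (L : tens X W) : (forall y, tev W D y L = 0) -> L = 0.
  move=> e; apply/eqP; rewrite -subr_eq0; apply/eqP/h => y.
  by rewrite linearB /= e subrr.
move=> L0; apply/lfunP => th; rewrite zero_lfunE.
(* By biduality the functional [th] on [X] is evaluation at some vector of [Y]; this is that vector
   in coordinates. *)
pose y := \sum_(i < \dim {:Y})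
  (th ((D^-1)%VF (dcoord i)) : k) *: (vbasis {:Y})`_i.
have thE xi : th xi = D xi y.
  rewrite -{1}(lker0_lfunK D0 xi) {1}(dual_coordE (D xi)) /y !linear_sum.
  apply: eq_bigr => i _; rewrite !linearZ /=; exact: mulrC.
rewrite -(L0 y); elim/tens_ind: L {L0} => [|x z hx hz|xi w].
- by rewrite linear0 zero_lfunE.
- by rewrite linearD /= -hx -hz add_lfunE.
by rewrite tpureE tev_pure thE.
Qed.

(** The canonical element, which corresponds to the identity of [V]. *)
Definition coev1 V : tens (dual V) V :=
  \sum_(i < \dim {:V}) tpure (dcoord i) (vbasis {:V})`_i.

Fixpoint coev V n : tens (tpow (dual V) n) (tpow V n) :=
  match n return tens (tpow (dual V) n) (tpow V n) with
  | 0 => tpure (tpow1 (dual V)) (tpow1 V)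
  | m.+1 => tswap _ _ _ _ (tpure (coev1 V) (coev V m))
  end.

(** By [tev_inj] this property determines [coev V n]: it is the canonical element of the whole
    tensor power. *)
Lemma tev_coev V n (x : tpow V n) : tev _ (tdual V n) x (coev V n) = x.
Proof.
elim: n x => [|n IH] x.
  by rewrite /= tev_pure tdual0 /GRing.scale /= mul1r; exact: mulr1.
elim/tpow_ind: x => [|x y hx hy|v x].
- elim/tens_ind: (coev V n.+1) => [|y z hy hz|xi w]; first exact: linear0.
    by rewrite linearD /= hy hz addr0.
  by rewrite tev_pure linear0 scale0r.
- rewrite -[in RHS]hx -[in RHS]hy.
  elim/tens_ind: (coev V n.+1) => [|a b ha hb|xi w].
  + by rewrite !linear0 addr0.
  + by rewrite !linearD /= ha hb addrACA.
  by rewrite !tev_pure linearD scalerDl.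
rewrite /=.
(* After the middle swap, contraction with [v] and contraction with [x] act on separate factors. *)
have E (M : tens (dual V) V) (N : tens (tpow (dual V) n) (tpow V n)) :
    tev (tpow V n.+1) (tdual V n.+1) (tpure v x : tpow V n.+1)
      (tswap _ _ _ _ (tpure M N)) =
    tpure (tev V \1%VF v M) (tev _ (tdual V n) x N) :> tpow V n.+1.
  elim/tens_ind: M => [|M M' h h'|xi u].
  - by rewrite tpure0l !linear0 tpure0l.
  - by rewrite tpureDl !linearD tpureDl /= h h'.
  elim/tens_ind: N => [|N N' h h'|eta y].
  - by rewrite tpure0r !linear0 tpure0r.
  - by rewrite tpureDr !linearD tpureDr /= h h'.
  rewrite tswap_pure !tev_pure tdualS tpureZl tpureZr scalerA.
  by rewrite id_lfunE.
rewrite E IH; congr (tpure _ _); rewrite linear_sum /=.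
rewrite [RHS](coord_vbasis (memvf v)); apply: eq_bigr => i _.
by rewrite tev_pure id_lfunE dcoordE.
Qed.

(** Contract both sides with [psi y]: invariance of the pairing leaves [psi] applied to the
    contraction with [y], that is [psi y]. *)
Lemma coev_invariant V (psi : cochain2 V) r s : is_C2 psi ->
  tmap (dual_cochain psi r s) (psi r s) (coev V (r + s)) = coev V (r + s).
Proof.
move=> p2; have [D0 Ds] := tdual_bij V (r + s).
have ps : limg (psi r s) = fullv by apply: lker0_limgf; apply: p2.
apply: (tev_inj D0 Ds) => x; rewrite tev_coev.
have [y ->] := lfun_surjP x ps; rewrite -[in RHS](tev_coev y).
elim/tens_ind: (coev _ _) => [|a b ha hb|xi w]; first by rewrite !linear0.
  by rewrite !linearD /= ha hb.
by rewrite tmap_pure !tev_pure dual_cochainE // linearZ.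
Qed.

Definition tflip U V : 'Hom(tens U V, tens V U) := tlift (fun u v => tpure v u).

Lemma tflip_pure U V (u : U) (v : V) : tflip U V (tpure u v) = tpure v u.
Proof.
by rewrite /tflip tlift_pure //; split=> [y a x z|y a x z];
  rewrite /= ?(tpurePl, tpurePr).
Qed.

(** The permutation that places [x] and [y] beside [v] and [u]. For [x (x) y] in the canonical
    element of [C_1] and [u (x) v] in [B_1^* (x) A_1], the two resulting factors are the sources of
    [cpi] for the two members of a product over [C]. *)
Definition tinsert X Y U V :
    'Hom(tens (tens X Y) (tens U V), tens (tens X V) (tens U Y)) :=
  (tmap \1 (tflip Y U) \o (tswap X Y V U \o tmap \1 (tflip U V)))%VF.

Lemma tinsert_pure X Y U V (x : X) (y : Y) (u : U) (v : V) :
  tinsert X Y U V (tpure (tpure x y) (tpure u v)) =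
  tpure (tpure x v) (tpure u y).
Proof.
rewrite 2!comp_lfunE tmap_pure id_lfunE tflip_pure tswap_pure tmap_pure.
by rewrite id_lfunE tflip_pure.
Qed.

Lemma tmap_tinsert X Y U V X' Y' U' V' (f : 'Hom(X, X')) (g : 'Hom(Y, Y'))
    (h : 'Hom(U, U')) (l : 'Hom(V, V')) :
  (tinsert X' Y' U' V' \o tmap (tmap f g) (tmap h l) =
   tmap (tmap f l) (tmap h g) \o tinsert X Y U V)%VF.
Proof.
apply: tens_ext22 => x y u v.
by rewrite comp_lfunE [RHS]comp_lfunE !(tmap_pure, tinsert_pure).
Qed.

Lemma tinsert_tswap X Y U V X' Y' U' V' (M : tens X Y) (P : tens U V)
    (M' : tens X' Y') (P' : tens U' V') :
  tmap (tswap _ _ _ _) (tswap _ _ _ _) (tswap _ _ _ _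
    (tpure (tinsert X Y U V (tpure M P)) (tinsert X' Y' U' V' (tpure M' P')))) =
  tinsert _ _ _ _
    (tpure (tswap _ _ _ _ (tpure M M')) (tswap _ _ _ _ (tpure P P'))).
Proof.
elim/tens_ind: M => [|M N h h'|x y].
- by do !rewrite ?tpure0l linear0.
- by do !rewrite ?tpureDl linearD /=; rewrite h h'.
elim/tens_ind: P => [|P N h h'|u v].
- by rewrite tpure0r linear0 !tpure0l !linear0 tpure0r linear0.
- by rewrite tpureDr !(tpureDl, linearD) /= tpureDr linearD /= h h'.
elim/tens_ind: M' => [|M' N h h'|x' y'].
- by rewrite tpure0l linear0 !tpure0r !linear0 tpure0l linear0.
- by rewrite tpureDl linearD /= !tpureDr !linearD /= tpureDl !linearD /= h h'.
elim/tens_ind: P' => [|P' N h h'|u' v'].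
- by do !rewrite ?tpure0r linear0.
- by do !rewrite ?tpureDr linearD /=; rewrite h h'.
by do !rewrite ?(tinsert_pure, tswap_pure, tmap_pure).
Qed.

(** * Insertion of the canonical element in tensor powers *)

Section Insertion.
Variables U V W : vectType k.

(* beta (x) a |-> sum_j (c^j (x) a) (x) (beta (x) c_j) *)
Definition coev_insert : 'Hom(tens U V, tens (tens (dual W) V) (tens U W)) :=
  linfun (fun M => tinsert _ _ U V (tpure (coev1 W) M)).

Lemma coev_insertE M : coev_insert M = tinsert _ _ U V (tpure (coev1 W) M).
Proof. by apply: linfunE => a x y; rewrite tpurePr linearP. Qed.

Definition coev_insert_pow n : 'Hom(tpow (tens U V) n,
    tens (tpow (tens (dual W) V) n) (tpow (tens U W) n)) :=
  (tshuf _ _ n \o tpmap coev_insert n)%VF.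

(** Inserting [coev1 W] in each tensor factor amounts, after shuffling, to a single insertion of
    [coev W n]; [tinsert_tswap] supplies the induction step. *)
Lemma coev_insert_powE n z :
  tmap (tshuf _ _ n) (tshuf _ _ n) (coev_insert_pow n z) =
  tinsert _ _ _ _ (tpure (coev W n) (tshuf _ _ n z)).
Proof.
elim: n z => [|n IH] z.
  rewrite [coev_insert_pow _ _]comp_lfunE tpmap0 !tshuf0 !linearZ.
  rewrite tpureZr linearZ /= tmap_pure tinsert_pure !tshuf0 !scale1r //.
elim/tpow_ind: z => [|z z' h h'|w z].
- by rewrite !linear0 tpure0r !linear0.
- by rewrite !linearD tpureDr !linearD /= h h'.
rewrite [coev_insert_pow _ _]comp_lfunE tpmapS tshufS coev_insertE.
rewrite -[tshuf _ _ n _]comp_lfunE -/(coev_insert_pow n).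
rewrite tshufS.
have E (M : tens (dual W) W) P Q :
  tmap (tshuf _ _ n.+1) (tshuf _ _ n.+1)
     (tswap _ _ _ _ (tpure (tinsert _ _ U V (tpure M P)) Q)) =
  tmap (tswap _ _ _ _) (tswap _ _ _ _) (tswap _ _ _ _ (tpure
    (tinsert _ _ U V (tpure M P)) (tmap (tshuf _ _ n) (tshuf _ _ n) Q))).
  move: (tinsert _ _ _ _ _) => R.
  elim/tens_ind: R => [|L L' h h'|a b].
  - by rewrite !tpure0l !linear0.
  - by rewrite !tpureDl !linearD /= h h'.
  elim/tens_ind: Q => [|L L' h h'|c d].
  - by rewrite linear0 !tpure0r !linear0.
  - by rewrite linearD !tpureDr !linearD /= h h'.
  by rewrite tswap_pure !tmap_pure tswap_pure tmap_pure !tshufS.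
by rewrite E IH tinsert_tswap.
Qed.

Lemma coev_insert_pow_join2 (a : cochain2 U) (b : cochain2 V)
    (c : cochain2 W) r s :
  is_C2 c ->
  (coev_insert_pow (r + s) \o join2 a b r s =
   tmap (join2 (dual_cochain c) b r s) (join2 a c r s) \o
     coev_insert_pow (r + s))%VF.
Proof.
move=> c2; apply/lfunP => z; rewrite comp_lfunE [RHS]comp_lfunE.
apply: (elimT lker0P (tmap_ker0 (tshuf_ker0 _ _ _) (tshuf_ker0 _ _ _))).
rewrite coev_insert_powE join2E.
have E : (tmap (tshuf _ _ (r + s)) (tshuf _ _ (r + s)) \o
      tmap (join2 (dual_cochain c) b r s) (join2 a c r s) =
    tmap (tmap (dual_cochain c r s) (b r s)) (tmap (a r s) (c r s)) \o
      tmap (tshuf _ _ (r + s)) (tshuf _ _ (r + s)))%VF.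
  rewrite !tmap_comp; congr tmap; apply/lfunP => x;
    by rewrite comp_lfunE join2E comp_lfunE.
(* Replacing the canonical element by its image makes [c] and its dual appear beside [a] and [b];
   naturality of [tinsert] then distributes the four operators. *)
rewrite (lfun_comp_eq E) coev_insert_powE -{1}(coev_invariant r s c2).
rewrite -(tmap_pure (tmap _ _)); exact: lfun_comp_eq (tmap_tinsert _ _ _ _) _.
Qed.

End Insertion.

End Coevaluation.

(** * Membership in Omega *)

Section ConicSpaces.
Variable k : fieldType.
Implicit Types A B H : cqs k.

Lemma cproj2_tcat A r s (x : tpow (gens A) r) (y : tpow (gens A) s) :
  cproj2 A r s (tcat x y) = tpure (cproj A r x) (cproj A s y).
Proof.
by rewrite comp_lfunE -tcatl_pure lker0_lfunK ?tcatl_ker0 // tmap_pure.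
Qed.

Lemma cmul_cproj2 A r s : (cmul A r s \o cproj2 A r s)%VF = cproj A (r + s).
Proof. by apply: tcat_ext => x y; rewrite comp_lfunE cproj2_tcat cmulE. Qed.

(** An injective map sending a finite-dimensional subspace into itself sends it onto itself. *)
Lemma admissibleP A (psi : cochain2 (gens A)) : is_C2 psi ->
  admissible psi <->
  forall r s x, cproj2 A r s x = 0 -> cproj2 A r s (psi r s x) = 0.
Proof.
move=> p2; split=> [ad r s x x0|st r s].
  by apply/eqP; rewrite -memv_ker -ad memv_img // memv_ker x0.
apply/eqP; rewrite eqEdim limg_dim_eq; last first.
  by rewrite (eqP (p2 r s)) capv0.
rewrite leqnn andbT; apply/subvP => _ /memv_imgP [x + ->].
by rewrite !memv_ker => /eqP /st ->.
Qed.

Lemma induced_cproj2 A (psi : cochain2 (gens A)) r s :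
  (forall x, cproj2 A r s x = 0 -> cproj2 A r s (psi r s x) = 0) ->
  (induced psi r s \o cproj2 A r s = cproj2 A r s \o psi r s)%VF.
Proof.
move=> st; rewrite -[RHS](lfun_descend (f := cproj2 A r s)).
  by rewrite /induced comp_lfunA.
by move=> x /st; rewrite comp_lfunE.
Qed.

Lemma cgenE A v : cgen A v = cproj A 1 (tpure v (tpow1 (gens A)) : tpow _ 1).
Proof.
rewrite comp_lfunE linfunE // => a x y; exact: tpurePl.
Qed.

Lemma piece0E A (a : piece A 0) : exists c : k, a = c *: cone A.
Proof.
have [c ->] := lfun_surjP a (cproj_surj A 0); exists c.
by rewrite -linearZ; congr (cproj A 0 _); apply: esym; exact: mulr1.
Qed.

(** Generation in degree one: products of a generator with elements of degree [n] span the next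
    degree. *)
Lemma piece_ind A n (P : piece A n.+1 -> Prop) :
  P 0 -> (forall x y, P x -> P y -> P (x + y)) ->
  (forall v a, P (cmul A 1 n (tpure (cgen A v) a))) -> forall a, P a.
Proof.
move=> P0 PD Pg a; have [x ->] := lfun_surjP a (cproj_surj A n.+1).
elim/tpow_ind: x => [|x y hx hy|v x]; first by rewrite linear0.
  by rewrite linearD; exact: PD.
have := Pg v (cproj A n x).
rewrite cgenE cmulE tcatS.
by rewrite tcat1.
Qed.

Lemma cgen_cprod A B : cgen (cprod A B) = tmap (cgen A) (cgen B).
Proof.
apply: tens_ext => a b; rewrite [LHS](@cgenE (cprod A B)) tmap_pure !cgenE.
rewrite [LHS]comp_lfunE tshufS tshuf0 scale1r tswap_pure.
exact: tmap_pure.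
Qed.

Lemma cgen_bij A : lker (cgen A) == 0%VS /\ limg (cgen A) = fullv.
Proof.
have l v : linfun (fun v => tpure v (tpow1 (gens A)) : tpow (gens A) 1) v =
    tpure v (tpow1 (gens A)).
  by apply: linfunE => a x y; exact: tpurePl.
split.
  apply: ker0_comp; first exact: cproj1_inj.
  apply/lker0P => u v; rewrite !l => /eqP; rewrite -subr_eq0 => /eqP e.
  apply/eqP; rewrite -subr_eq0; apply/eqP.
  apply: (@tpure_eq0 _ _ _ _ (tpow1 (gens A))); last exact: oner_neq0.
  by rewrite -[RHS]e -scaleN1r addrC tpurePl scaleN1r addrC.
apply: surj_comp; first exact: cproj_surj.
apply/eqP; rewrite eqEsubv subvf; apply/subvP => x _.
elim/tpow_ind: x => [|x y hx hy|v c]; rewrite ?mem0v //; first exact: memvD.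
have -> : c = (c : k) *: tpow1 (gens A) by apply: esym; exact: mulr1.
by rewrite tpureZr memvZ // -l memv_img ?memvf.
Qed.

End ConicSpaces.

(** * Admissibility and multiplicativity on lifts to the tensor algebra *)

Section OmegaCharacterization.
Variable k : fieldType.
Variables (A B : cqs k) (X : comma_obj A B).
Local Notation H := (cobj X).
Local Notation U := (tens (dual (gens B)) (gens A)).
Local Notation p := (tmap (cpi X) \1%VF
  : 'Hom(tens U (gens B), tens (gens H) (gens B))).
Local Notation psub := (tmap (cpi_sub X) \1%VF
  : 'Hom(tens U (gens B), gens (cprod (csub X) B))).
Local Notation incl := (tmap (sub_incl (cspan X)) \1%VF
  : 'Hom(gens (cprod (csub X) B), tens (gens H) (gens B))).
Local Notation pincl n := (tmap (sub_pincl (cspan X) n) \1%VF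
  : 'Hom(piece (cprod (csub X) B) n, piece (cprod H B) n)).

(** The projection of the tensor algebra to [H^phi o B], viewed inside [H o B]
    ([pincl_comma_proj]). *)
Definition comma_proj n : 'Hom(tpow (tens U (gens B)) n, piece (cprod H B) n) :=
  (cproj (cprod H B) n \o tpmap p n)%VF.

Definition comma_proj2 r s : 'Hom(tpow (tens U (gens B)) (r + s),
    tens (piece (cprod H B) r) (piece (cprod H B) s)) :=
  (cproj2 (cprod H B) r s \o tpmap p (r + s))%VF.

Lemma comma_proj2_tcat r s x y :
  comma_proj2 r s (tcat x y) = tpure (comma_proj r x) (comma_proj s y).
Proof.
by rewrite comp_lfunE tpmap_cat [LHS](@cproj2_tcat k (cprod H B)) -!comp_lfunE.
Qed.

Lemma cmul_comma_proj2 r s :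
  (cmul (cprod H B) r s \o comma_proj2 r s)%VF = comma_proj (r + s).
Proof. by rewrite comp_lfunA cmul_cproj2. Qed.

Lemma incl_ker0 : lker incl == 0%VS.
Proof. by rewrite tmap_ker0 ?id_ker0 // sub_incl_ker0. Qed.

Lemma pincl_ker0 n : lker (pincl n) == 0%VS.
Proof.
rewrite tmap_ker0 ?id_ker0 //.
by apply/lker0P => x y; rewrite !lfunE; exact: val_inj.
Qed.

Lemma incl_psub : (incl \o psub)%VF = p.
Proof.
rewrite tmap_comp comp_lfun1l; congr tmap; apply/lfunP => x.
rewrite comp_lfunE [cpi_sub X x]comp_lfunE !lfunE /=.
by rewrite vsprojK // memv_img ?memvf.
Qed.

Lemma tpmap_psub n x : tpmap p n x = tpmap incl n (tpmap psub n x).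
Proof. by rewrite -incl_psub -tpmap_comp comp_lfunE. Qed.

Lemma psub_surj : limg psub = fullv.
Proof.
rewrite tmap_surj ?lim1g //; apply/eqP; rewrite eqEsubv subvf; apply/subvP.
move=> v _; have /memv_imgP [x _ Ex] : val v \in limg (cpi X) by exact: subvsP.
suff -> : v = cpi_sub X x by rewrite memv_img ?memvf.
apply: val_inj; rewrite Ex [cpi_sub X x]comp_lfunE lfunE /=.
by rewrite vsprojK // memv_img ?memvf.
Qed.

Lemma pincl_cproj n :
  (pincl n \o cproj (cprod (csub X) B) n =
   cproj (cprod H B) n \o tpmap incl n)%VF.
Proof.
apply/lfunP => x; rewrite comp_lfunE [RHS]comp_lfunE.
rewrite [cproj (cprod (csub X) B) n x]comp_lfunE [RHS]comp_lfunE.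
rewrite (lfun_comp_eq (tshuf_tpmap _ _ _)) tpmap_id; apply: lfun_comp_eq.
rewrite !tmap_comp comp_lfun1l comp_lfun1r; congr tmap; apply/lfunP => y.
by rewrite comp_lfunE sub_projE.
Qed.

Lemma pincl_cproj2 r s :
  (tmap (pincl r) (pincl s) \o cproj2 (cprod (csub X) B) r s =
   cproj2 (cprod H B) r s \o tpmap incl (r + s))%VF.
Proof.
apply: tcat_ext => x y.
rewrite comp_lfunE [RHS]comp_lfunE tpmap_cat !cproj2_tcat tmap_pure.
by rewrite !(lfun_comp_eq (pincl_cproj _)).
Qed.

Lemma pincl_comma_proj n x :
  pincl n (cproj (cprod (csub X) B) n (tpmap psub n x)) = comma_proj n x.
Proof.
by rewrite (lfun_comp_eq (pincl_cproj n)) [RHS]comp_lfunE tpmap_psub.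
Qed.

Lemma pincl_comma_proj2 r s x :
  tmap (pincl r) (pincl s)
    (cproj2 (cprod (csub X) B) r s (tpmap psub (r + s) x)) = comma_proj2 r s x.
Proof.
by rewrite (lfun_comp_eq (pincl_cproj2 r s)) [RHS]comp_lfunE tpmap_psub.
Qed.

(** Multiplicativity of phi for the twisted product, expressed on lifts [z], [z'] so that the
    descended cocycle does not appear. *)
Definition comma_mult (w : cochain2 (tens U (gens B))) :=
  forall r s z z' a a', cmap X r a = comma_proj r z ->
    cmap X s a' = comma_proj s z' ->
    cmap X (r + s) (cmul A r s (tpure a a')) =
    comma_proj (r + s) (w r s (tcat z z')).

Lemma cmap_gen_cgen v :
  cmap X 1 (cgen A v) = tmap (cgen H) (cgen B) (cmap_gen X v).
Proof.
rewrite /cmap_gen comp_lfunE [in RHS]comp_lfunE -[RHS]comp_lfunE tmap_comp.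
by rewrite !surj_compfV ?(cgen_bij _).2 // tmap_id id_lfunE.
Qed.

Lemma cmap_gen_cpi v : exists w, cmap_gen X v = p w.
Proof.
exists (\sum_(j < \dim {:gens B})
  tpure (tpure (dcoord j) v) (vbasis {:gens B})`_j).
rewrite linear_sum /= (cmap_genE (b := vbasis {:gens B})
  (bd := @dcoord k (gens B)) X v (vbasisP _)).
  by apply: eq_bigr => j _; rewrite tmap_pure id_lfunE.
by move=> i j; rewrite dcoordE coord_free ?(basis_free (vbasisP _)) // eq_sym.
Qed.

(** Induction on the degree: lifts of the unit and of phi on generators exist, and [comma_mult]
    turns lifts of two factors into a lift of their product. Hence phi takes its values in
    [H^phi o B]. *)
Lemma comma_lift w : cmap X 0 (cone A) = cone (cprod H B) -> comma_mult w ->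
  forall n a, exists z, cmap X n a = comma_proj n z.
Proof.
move=> U1 M; elim=> [a|n IH].
  have [c ->] := piece0E a; exists (c *: tpow1 _ : tpow (tens U (gens B)) 0).
  by rewrite !linearZ /= U1 [in RHS]comp_lfunE tpmap0.
elim/piece_ind => [|x y [z hz] [z' hz']|v a].
- by exists 0; rewrite !linear0.
- by exists (z + z'); rewrite !linearD /= hz hz'.
have [z hz] := IH a; have [y hy] := cmap_gen_cpi v.
pose y1 : tpow (tens U (gens B)) 1 := tpure y (tpow1 (tens U (gens B))).
exists (w 1%N n (tcat y1 z)).
refine (M 1%N n _ z (cgen A v) a _ hz).
rewrite cmap_gen_cgen hy -cgen_cprod [LHS](@cgenE k (cprod H B)).
by rewrite [RHS]comp_lfunE tpmapS tpmap0.
Qed.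

(* Lifting everything to the tensor algebra of U (x) B_1 replaces H^phi by H. *)
Lemma in_OmegaP (w : cochain2 (tens U (gens B))) : is_Z2 w ->
  in_Omega X w <->
  [/\ forall r s x, tpmap p (r + s) x = 0 -> tpmap p (r + s) (w r s x) = 0,
      forall r s x, comma_proj2 r s x = 0 -> comma_proj2 r s (w r s x) = 0,
      cmap X 0 (cone A) = cone (cprod H B) & comma_mult w].
Proof.
move=> wZ.
have tI n := elimT lker0P (tpmap_ker0 n incl_ker0).
have pI n := elimT lker0P (pincl_ker0 n).
have p2I r s := elimT lker0P (tmap_ker0 (pincl_ker0 r) (pincl_ker0 s)).
have coneE : pincl 0 (cone (cprod (csub X) B)) = cone (cprod H B).
  by rewrite /cone (lfun_comp_eq (pincl_cproj 0)) tpmap0.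
split.
  case=> w' [de w'Z ad [f [fE [f1 fM]]]].
  have {}de r s x :
      w' r s (tpmap psub (r + s) x) = tpmap psub (r + s) (w r s x).
    exact: lfun_comp_eq (de r s) _.
  have w'2 : is_C2 w' by case: w'Z.
  have {}ad := (admissibleP w'2).1 ad.
  split.
  - move=> r s x x0; rewrite tpmap_psub -de; have -> : tpmap psub (r + s) x = 0.
      by apply: tI; rewrite -tpmap_psub x0 linear0.
    by rewrite !linear0.
  - move=> r s x x0; rewrite -pincl_comma_proj2 -de ad ?linear0 //.
    by apply: p2I; rewrite pincl_comma_proj2 x0 linear0.
  - by rewrite fE comp_lfunE [f 0%N _]f1 coneE.
  move=> r s z z' a a' ha ha'.
  have fa : f r a = cproj (cprod (csub X) B) r (tpmap psub r z).
    by apply: pI; rewrite pincl_comma_proj -ha fE comp_lfunE.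
  have fa' : f s a' = cproj (cprod (csub X) B) s (tpmap psub s z').
    by apply: pI; rewrite pincl_comma_proj -ha' fE comp_lfunE.
  have e : f (r + s)%N (cmul A r s (tpure a a')) =
      cmul _ r s (induced w' r s (tpure (f r a) (f s a'))).
    rewrite -[tpure (f r a) _]tmap_pure -[RHS]comp_lfunE.
    exact: lfun_comp_eq (fM r s) (tpure a a').
  rewrite fE comp_lfunE e fa fa' -cproj2_tcat -tpmap_cat.
  rewrite (lfun_comp_eq (induced_cproj2 (ad r s))) de.
  by rewrite -(comp_lfunE (cmul _ _ _)) cmul_cproj2 pincl_comma_proj.
case=> K1 K2 U1 M; have L := comma_lift U1 M.
have ps n := tpmap_surj n psub_surj.
(* The descended cocycle. The first condition makes it independent of the preimage chosen by the
   generalized inverse. *)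
pose w' : cochain2 (gens (cprod (csub X) B)) := fun r s =>
  (tpmap psub (r + s) \o w r s \o (tpmap psub (r + s))^-1)%VF.
have de r s : (w' r s \o tpmap psub (r + s) = tpmap psub (r + s) \o w r s)%VF.
  apply: lfun_descend => x x0; rewrite comp_lfunE; apply: tI.
  by rewrite linear0 -tpmap_psub K1 // tpmap_psub x0 linear0.
have w'Z := descend_Z2 psub_surj de wZ.
have w'2 : is_C2 w' by case: w'Z.
have ad r s x : cproj2 (cprod (csub X) B) r s x = 0 ->
    cproj2 (cprod (csub X) B) r s (w' r s x) = 0.
  have [x' ->] := lfun_surjP x (ps _).
  rewrite (lfun_comp_eq (de r s)) => x0; apply: p2I.
  by rewrite pincl_comma_proj2 linear0 K2 // -pincl_comma_proj2 x0 linear0.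
exists w'; split=> //; first exact/(admissibleP w'2).
exists (fun n => (pincl n)^-1 \o cmap X n)%VF.
have fE n a z : cmap X n a = comma_proj n z ->
    ((pincl n)^-1 \o cmap X n)%VF a =
    cproj (cprod (csub X) B) n (tpmap psub n z).
  by move=> h; rewrite comp_lfunE h -pincl_comma_proj lker0_lfunK ?pincl_ker0.
split.
  move=> n; apply/lfunP => a; have [z hz] := L n a.
  by rewrite comp_lfunE (fE _ _ _ hz) pincl_comma_proj.
split.
  by rewrite /= comp_lfunE [cmap X 0 _]U1 -coneE lker0_lfunK ?pincl_ker0.
move=> r s; apply: tens_ext => a a'.
rewrite comp_lfunE [RHS]comp_lfunE tmap_pure.
have [z hz] := L r a; have [z' hz'] := L s a'.
rewrite [LHS](fE _ _ _ (M _ _ _ _ _ _ hz hz')) [RHS]comp_lfunE.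
rewrite (fE _ _ _ hz) (fE _ _ _ hz').
suff <- : induced w' r s (cproj2 (cprod (csub X) B) r s
    (tcat (tpmap psub r z) (tpmap psub s z'))) = induced w' r s (tpure
    (cproj (cprod (csub X) B) r (tpmap psub r z))
    (cproj (cprod (csub X) B) s (tpmap psub s z'))).
  rewrite (lfun_comp_eq (induced_cproj2 (ad r s))) -tpmap_cat.
  rewrite (lfun_comp_eq (de r s)) -[RHS]comp_lfunE.
  by congr (fun_of_lfun _ _); rewrite cmul_cproj2.
by rewrite cproj2_tcat.
Qed.

End OmegaCharacterization.

(** * Factorized cocycles *)

Section FactorizedOmega.
Variable k : fieldType.

(** The middle swap separates the two factors, so that kernels and operators can be studied on [H]
    and on [B] apart. *)
Lemma tswap_cproj2 (H B : cqs k) r s :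
  (tswap _ _ _ _ \o cproj2 (cprod H B) r s =
   tmap (cproj2 H r s) (cproj2 B r s) \o tshuf (gens H) (gens B) (r + s))%VF.
Proof.
apply: tcat_ext => x y.
rewrite comp_lfunE [RHS]comp_lfunE (@cproj2_tcat k (cprod H B)) tshuf_cat.
rewrite [cproj (cprod H B) r x]comp_lfunE [cproj (cprod H B) s y]comp_lfunE.
move: (tshuf _ _ r x) (tshuf _ _ s y) => w w'.
elim/tens_ind: w => [|w1 w2 h1 h2|x1 x2].
- by rewrite (bilin0l (tcat2_bilin _ _ _ _)) !linear0 tpure0l linear0.
- rewrite (bilinDl (tcat2_bilin _ _ _ _)) !linearD tpureDl linearD /=.
  by rewrite h1 h2.
elim/tens_ind: w' => [|w1 w2 h1 h2|y1 y2].
- by rewrite (bilin0r (tcat2_bilin _ _ _ _)) !linear0 tpure0r linear0.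
- rewrite (bilinDr (tcat2_bilin _ _ _ _)) !linearD tpureDr linearD /=.
  by rewrite h1 h2.
by rewrite tcat2_pure !tmap_pure tswap_pure !cproj2_tcat.
Qed.

Lemma cprod_cmul (H B : cqs k) r s y :
  cmul (cprod H B) r s y = tmap (cmul H r s) (cmul B r s) (tswap _ _ _ _ y).
Proof.
rewrite -comp_lfunE; congr (fun_of_lfun _ y); apply: tens_ext => u v.
by rewrite comp_lfunE; exact: cprod_cmulE.
Qed.

(** The shuffle embeds the power into one with a tensor factor [tpow (dual V) n], which pairs
    faithfully with [tpow V n]. *)
Lemma tpow_tens_dual_eq0 (V W : vectType k) n :
  (forall b : tpow V n, b = 0) -> forall x : tpow (tens (dual V) W) n, x = 0.
Proof.
move=> b0 x; apply: (elimT lker0P (tshuf_ker0 _ _ n)); rewrite linear0.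
elim/tens_ind: (tshuf _ _ n x) => [//|y z -> ->|xi w]; first exact: addr0.
have -> : xi = 0; last exact: tpure0l.
by apply: tdual_inj => v; rewrite (b0 v) !linear0.
Qed.

Variables (A B : cqs k) (X : comma_obj A B).
Local Notation H := (cobj X).
Local Notation U := (tens (dual (gens B)) (gens A)).
Local Notation p := (tmap (cpi X) \1%VF
  : 'Hom(tens U (gens B), tens (gens H) (gens B))).
Variable sigma : cochain2 U.
Hypothesis sigmaZ : is_Z2 sigma.
Let w := join2 sigma (@id_cochain k (gens B)).

Definition cpi_proj2 r s : 'Hom(tpow U (r + s), tens (piece H r) (piece H s)) :=
  (cproj2 H r s \o tpmap (cpi X) (r + s))%VF.

Lemma tshuf_tpmap_p n x :
  tshuf _ _ n (tpmap p n x) = tmap (tpmap (cpi X) n) \1 (tshuf _ _ n x).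
Proof. by rewrite (lfun_comp_eq (tshuf_tpmap _ _ n)) tpmap_id. Qed.

Lemma tswap_comma_proj2 r s x :
  tswap _ _ _ _ (comma_proj2 X r s x) =
  tmap (cpi_proj2 r s) (cproj2 B r s) (tshuf _ _ (r + s) x).
Proof.
rewrite [comma_proj2 X r s x]comp_lfunE (lfun_comp_eq (tswap_cproj2 H B r s)).
by rewrite tshuf_tpmap_p -comp_lfunE tmap_comp comp_lfun1r.
Qed.

(** Multiplicativity of phi when the product of [H o B] is twisted by [T] on the [H] factor
    alone. *)
Definition twisted_mult (T : forall r s, 'End(tens (piece H r) (piece H s))) :=
  forall r s a a', cmap X (r + s) (cmul A r s (tpure a a')) =
    tmap (cmul H r s) (cmul B r s) (tmap (T r s) \1
      (tswap _ _ _ _ (tpure (cmap X r a) (cmap X s a')))).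

Lemma tmap_cproj2_join2
    (T : forall r s, 'End(tens (piece H r) (piece H s))) r s :
  ((exists b : tens (piece B r) (piece B s), b != 0) ->
    (T r s \o cpi_proj2 r s = cpi_proj2 r s \o sigma r s)%VF) ->
  forall x, tswap _ _ _ _ (comma_proj2 X r s (w r s x)) =
    tmap (T r s) \1 (tswap _ _ _ _ (comma_proj2 X r s x)).
Proof.
move=> hT x; rewrite !tswap_comma_proj2 join2E.
apply: lfun_comp_eq; apply: esym; apply: tmap_intertwine => -[b b0]; apply: hT.
by exists (cproj2 B r s b).
Qed.

Lemma comma_proj_join2
    (T : forall r s, 'End(tens (piece H r) (piece H s))) r s :
  ((exists b : tens (piece B r) (piece B s), b != 0) ->
    (T r s \o cpi_proj2 r s = cpi_proj2 r s \o sigma r s)%VF) ->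
  forall z z', comma_proj X (r + s) (w r s (tcat z z')) =
    tmap (cmul H r s) (cmul B r s) (tmap (T r s) \1
      (tswap _ _ _ _ (tpure (comma_proj X r z) (comma_proj X s z')))).
Proof.
move=> hT z z'; rewrite -cmul_comma_proj2 comp_lfunE.
by rewrite cprod_cmul (tmap_cproj2_join2 hT) comma_proj2_tcat.
Qed.

(* The guard on T is forced: admissibility of omega says nothing about sigma in
   the bidegrees where B_r (x) B_s = 0. No guard is needed for cpi, because U
   vanishes when B_1 does. *)
Lemma in_Omega_join2P : in_Omega X w <->
  [/\ forall r s x, tpmap (cpi X) (r + s) x = 0 ->
        tpmap (cpi X) (r + s) (sigma r s x) = 0,
      cmap X 0 (cone A) = cone (cprod H B) &
      exists T : forall r s, 'End(tens (piece H r) (piece H s)),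
        twisted_mult T /\ forall r s,
          (exists b : tens (piece B r) (piece B s), b != 0) ->
          (T r s \o cpi_proj2 r s = cpi_proj2 r s \o sigma r s)%VF].
Proof.
have wZ : is_Z2 w by apply: join2_Z2 => //; exact: id_cochain_Z2.
have SI (V W : vectType k) n := elimT lker0P (tshuf_ker0 V W n).
split=> [/(in_OmegaP X wZ) [K1 K2 U1 M]|[K1 U1 [T [M hT]]]]; last first.
  apply/(in_OmegaP X wZ); split=> //.
  - move=> r s x x0; apply: SI; rewrite tshuf_tpmap_p join2E linear0.
    have E : (tpmap (cpi X) (r + s) \o sigma r s \o
        (tpmap (cpi X) (r + s))^-1 \o tpmap (cpi X) (r + s) =
        tpmap (cpi X) (r + s) \o sigma r s)%VF.
      by apply: lfun_descend => y /K1; rewrite comp_lfunE.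
    have /lfun_comp_eq <- := tmap_intertwine
      (g := \1%VF : 'End(tpow (gens B) (r + s))) (fun _ => E).
    by rewrite -tshuf_tpmap_p x0 !linear0.
  - move=> r s x x0; apply: (elimT lker0P (tswap_ker0 _ _ _ _)).
    by rewrite (tmap_cproj2_join2 (hT r s)) x0 !linear0.
  move=> r s z z' a a' ha ha'.
  by rewrite (comma_proj_join2 (hT r s)) -ha -ha' M.
(* The operator induced by [sigma] along [cpi_proj2], provided [sigma] preserves its kernel. *)
pose T r s := (cpi_proj2 r s \o sigma r s \o (cpi_proj2 r s)^-1)%VF.
have hT r s : (exists b : tens (piece B r) (piece B s), b != 0) ->
  (T r s \o cpi_proj2 r s = cpi_proj2 r s \o sigma r s)%VF.
  case=> b b0; apply: lfun_descend => x x0.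
  have [y yb] : exists y, b = cproj2 B r s y.
    apply: lfun_surjP; apply: surj_comp.
      by rewrite tmap_surj // cproj_surj.
    apply: (@lfun_cancel_surj _ _ _ _ (tcatl (gens B) r s)).
    by rewrite lker0_compVf // tcatl_ker0.
  (* Attaching [y] to [x] brings admissibility of omega to bear. Omega acts trivially on the second
     factor, so the nonzero [b] survives and can be cancelled. *)
  set z := ((tshuf _ _ (r + s))^-1)%VF (tpure x y).
  have z0 : comma_proj2 X r s z = 0.
    apply: (elimT lker0P (tswap_ker0 _ _ _ _)).
    by rewrite tswap_comma_proj2 tshufVK tmap_pure x0 tpure0l linear0.
  have := congr1 (tswap _ _ _ _) (K2 _ _ _ z0).
  rewrite tswap_comma_proj2 join2E tshufVK !tmap_pure id_lfunE -yb linear0.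
  by move=> e; rewrite comp_lfunE; exact: tpure_eq0 e b0.
split=> //; last first.
  exists T; split=> // r s a a'.
  have [z hz] := comma_lift U1 M a; have [z' hz'] := comma_lift U1 M a'.
  by rewrite (M _ _ _ _ _ _ hz hz') hz hz' (comma_proj_join2 (hT r s)).
move=> r s x x0.
have [[b b0]|nb] := pselect (exists b : tpow (gens B) (r + s), b != 0).
  set z := ((tshuf _ _ (r + s))^-1)%VF (tpure x b).
  have z0 : tpmap p (r + s) z = 0.
    by apply: SI; rewrite tshuf_tpmap_p tshufVK tmap_pure x0 tpure0l linear0.
  have := congr1 (tshuf _ _ _) (K1 _ _ _ z0).
  rewrite tshuf_tpmap_p join2E tshufVK !tmap_pure !id_lfunE linear0 => e.
  exact: tpure_eq0 e b0.
rewrite [sigma r s x]tpow_tens_dual_eq0 ?linear0 // => b.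
by have [//|b0] := eqVneq b 0; case: nb; exists b.
Qed.

End FactorizedOmega.

(** * Products and units *)

Section Product.
Variable k : fieldType.

Lemma tmap_tassoc (U V W U' V' W' : vectType k) (f : 'Hom(U, U'))
    (g : 'Hom(V, V')) (h : 'Hom(W, W')) :
  (tmap (tmap f g) h \o tassoc U V W = tassoc U' V' W' \o tmap f (tmap g h))%VF.
Proof.
apply: tens_ext => u m; rewrite comp_lfunE [RHS]comp_lfunE tmap_pure.
elim/tens_ind: m => [|x y hx hy|v w].
- by rewrite tpure0r !linear0 tpure0r linear0.
- by rewrite tpureDr !linearD tpureDr linearD /= hx hy.
by rewrite tassoc_pure !tmap_pure tassoc_pure.
Qed.

Lemma tcontr_tassoc (U V W : vectType k) (beta : dual W) (u : U)
    (m : tens V W) :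
  tcontr (tens U V) beta (tassoc U V W (tpure u m)) = tpure u (tcontr V beta m).
Proof.
elim/tens_ind: m => [|x y hx hy|v w].
- by rewrite tpure0r !linear0 tpure0r.
- by rewrite tpureDr !linearD tpureDr /= hx hy.
by rewrite tassoc_pure !tcontr_pure tpureZr.
Qed.

Variables (A C B : cqs k) (X : comma_obj A C) (Y : comma_obj C B).
Local Notation Z := (comma_prod X Y).
Local Notation H := (cobj X).
Local Notation G := (cobj Y).

Lemma cmap_gen_prod a :
  cmap_gen Z a = tassoc _ _ _ (tmap \1 (cmap_gen Y) (cmap_gen X a)).
Proof.
have I : lker (tmap (cgen (cprod H G)) (cgen B)) == 0%VS.
  by rewrite tmap_ker0 ?(cgen_bij _).1.
apply: (elimT lker0P I); rewrite -(cmap_gen_cgen Z) [LHS]comp_lfunE.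
rewrite [in LHS]comp_lfunE cmap_gen_cgen cgen_cprod.
rewrite (lfun_comp_eq (tmap_tassoc _ _ _)); congr (tassoc _ _ _ _).
apply: lfun_comp_eq; rewrite !tmap_comp comp_lfun1l comp_lfun1r; congr tmap.
by apply/lfunP => c; rewrite [LHS]comp_lfunE cmap_gen_cgen [RHS]comp_lfunE.
Qed.

(** Expand phi on a generator of [A] over a basis [c_j] of [C_1]; applying the second map to [c_j]
    and contracting with [beta] gives the sum over inserted pairs [c^j], [c_j]. *)
Lemma cpi_prod :
  cpi Z = (tmap (cpi X) (cpi Y) \o
    coev_insert (dual (gens B)) (gens A) (gens C))%VF.
Proof.
apply: tens_ext => beta a; rewrite comp_lfunE coev_insertE.
rewrite cpi_pure cmap_gen_prod.
rewrite (cmap_genE (b := vbasis {:gens C}) (bd := @dcoord k (gens C)) X a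
  (vbasisP _)); last first.
  by move=> i j; rewrite dcoordE coord_free ?(basis_free (vbasisP _)) // eq_sym.
rewrite /coev1 (bilin_suml (tpure_bilin _ _)) !linear_sum.
apply: eq_bigr => j _ /=.
by rewrite tinsert_pure !tmap_pure id_lfunE tcontr_tassoc -cpi_pure.
Qed.

Lemma tshuf_tpmap_cpi_prod n :
  (tshuf _ _ n \o tpmap (cpi Z) n =
   tmap (tpmap (cpi X) n) (tpmap (cpi Y) n) \o coev_insert_pow _ _ _ n)%VF.
Proof. by rewrite cpi_prod -tpmap_comp !comp_lfunA tshuf_tpmap. Qed.

Lemma tswap_cpi_proj2_prod r s :
  (tswap _ _ _ _ \o cpi_proj2 Z r s =
   tmap (cpi_proj2 X r s) (cpi_proj2 Y r s) \o
     coev_insert_pow _ _ _ (r + s))%VF.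
Proof.
apply/lfunP => x.
rewrite comp_lfunE [RHS]comp_lfunE [cpi_proj2 Z r s x]comp_lfunE.
rewrite (lfun_comp_eq (tswap_cproj2 H G r s)).
rewrite (lfun_comp_eq (tshuf_tpmap_cpi_prod _)) -comp_lfunE.
by rewrite tmap_comp.
Qed.

Definition prod_twist (TX : forall r s, 'End(tens (piece H r) (piece H s)))
    (TY : forall r s, 'End(tens (piece G r) (piece G s))) r s :
    'End(tens (piece (cprod H G) r) (piece (cprod H G) s)) :=
  (tswap _ _ _ _ \o tmap (TX r s) (TY r s) \o tswap _ _ _ _)%VF.

Lemma tswap_prod_twist TX TY r s x :
  tswap _ _ _ _ (prod_twist TX TY r s x) =
  tmap (TX r s) (TY r s) (tswap _ _ _ _ x).
Proof. by rewrite [prod_twist _ _ _ _ x]comp_lfunE comp_lfunE tswapKE. Qed.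

(** Once phi of both arguments is expanded into pure tensors [h (x) c], the first identity
    multiplies the [c] parts in [C], where the second identity applies. *)
Lemma twisted_mult_prod TX TY :
  twisted_mult TX -> twisted_mult TY ->
  twisted_mult (X := Z) (prod_twist TX TY).
Proof.
move=> MX MY r s a a'.
have cE n c : cmap Z n c = tassoc _ _ _ (tmap \1 (cmap Y n) (cmap X n c)).
  by rewrite [LHS]comp_lfunE comp_lfunE.
rewrite !cE MX; move: (cmap X r a) (cmap X s a') => w w'.
elim/tens_ind: w => [|w1 w2 h1 h2|h c].
- by do !rewrite ?tpure0l linear0.
- by do !rewrite ?tpureDl linearD /=; rewrite h1 h2.
elim/tens_ind: w' => [|w1 w2 h1 h2|h' c'].
- by do !rewrite ?tpure0r linear0.
- by do !rewrite ?tpureDr linearD /=; rewrite h1 h2.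
rewrite tswap_pure !tmap_pure !id_lfunE MY.
move: (cmap Y r c) (cmap Y s c') => w w'.
elim/tens_ind: w => [|w1 w2 h1 h2|g b].
- by do !rewrite ?tpure0l ?tpure0r linear0.
- by do !rewrite ?tpureDl ?tpureDr linearD /=; rewrite h1 h2.
elim/tens_ind: w' => [|w1 w2 h1 h2|g' b'].
- by do !rewrite ?tpure0l ?tpure0r linear0.
- by do !rewrite ?tpureDl ?tpureDr linearD /=; rewrite h1 h2.
rewrite tswap_pure !tmap_pure !tassoc_pure !tswap_pure !tmap_pure !id_lfunE.
by rewrite cprod_cmul tswap_prod_twist tswap_pure !tmap_pure.
Qed.

Variables (a : cochain2 (gens A)) (b : cochain2 (gens B)).
Variable c : cochain2 (gens C).
Hypotheses (aZ : is_Z2 a) (bZ : is_Z2 b) (cZ : is_Z2 c).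
Let sigma (D E : cqs k) (d : cochain2 (gens D)) (e : cochain2 (gens E)) :=
  join2 (dual_cochain e) d.

(** The relation for [TX] is available only where [C_r (x) C_s] is nonzero, while the product
    requires it where [B_r (x) B_s] is nonzero. The dimension hypothesis bridges the two guards. *)
Lemma in_Omega_prod :
  (forall n, \dim {: piece C n} = 0%N -> \dim {: piece B n} = 0%N) ->
  in_Omega X (join2 (sigma a c) (@id_cochain k _)) ->
  in_Omega Y (join2 (sigma c b) (@id_cochain k _)) ->
  in_Omega Z (join2 (sigma a b) (@id_cochain k _)).
Proof.
have sZ (D E : cqs k) (d : cochain2 (gens D)) (e : cochain2 (gens E)) :
    is_Z2 d -> is_Z2 e -> is_Z2 (sigma d e).
  by move=> dZ eZ; apply: join2_Z2 => //; exact: dual_cochain_Z2.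
have c2 : is_C2 c by case: cZ.
move=> dimCB /(in_Omega_join2P X (sZ _ _ _ _ aZ cZ)) [KX UX [TX [MX hX]]].
move=> /(in_Omega_join2P Y (sZ _ _ _ _ cZ bZ)) [KY UY [TY [MY hY]]].
apply/(in_Omega_join2P Z (sZ _ _ _ _ aZ bZ)); split.
- move=> r s x x0; apply: (elimT lker0P (tshuf_ker0 _ _ _)); rewrite linear0.
  rewrite (lfun_comp_eq (tshuf_tpmap_cpi_prod _)).
  rewrite (lfun_comp_eq (coev_insert_pow_join2 _ _ r s c2)).
  have EX : (tpmap (cpi X) (r + s) \o sigma a c r s \o
      (tpmap (cpi X) (r + s))^-1 \o tpmap (cpi X) (r + s) =
      tpmap (cpi X) (r + s) \o sigma a c r s)%VF.
    by apply: lfun_descend => y /KX; rewrite comp_lfunE.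
  have EY : (tpmap (cpi Y) (r + s) \o sigma c b r s \o
      (tpmap (cpi Y) (r + s))^-1 \o tpmap (cpi Y) (r + s) =
      tpmap (cpi Y) (r + s) \o sigma c b r s)%VF.
    by apply: lfun_descend => y /KY; rewrite comp_lfunE.
  (* [EX] and [EY] express the result through the image of [x] under the product's own [cpi], which
     is zero. *)
  rewrite -comp_lfunE tmap_comp -EX -EY -tmap_comp comp_lfunE.
  by rewrite -(lfun_comp_eq (tshuf_tpmap_cpi_prod _)) x0 !linear0.
- rewrite [LHS]comp_lfunE [X in tassoc _ _ _ X]comp_lfunE UX !cprod_cone.
  by rewrite tmap_pure id_lfunE UY cprod_cone tassoc_pure.
exists (prod_twist TX TY); split; first exact: twisted_mult_prod.
move=> r s [w w0].
have nzC n (y : piece B n) : y != 0 -> exists z : piece C n, z != 0.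
  move=> y0; exists (vpick {:piece C n}); rewrite vpick0 -dimv_eq0.
  apply: contra y0 => /eqP/dimCB/eqP; rewrite dimv_eq0 => /eqP B0.
  by rewrite -memv0 -B0 memvf.
have [z z0] : exists z : tens (piece C r) (piece C s), z != 0.
  have [yr yr0] : exists y : piece B r, y != 0.
    apply: contrapT => nr; case/eqP: w0; elim/tens_ind: w => [//|y z -> ->|u v].
      exact: addr0.
    have [->|u0] := eqVneq u 0; first exact: tpure0l.
    by case: nr; exists u.
  have [ys ys0] : exists y : piece B s, y != 0.
    apply: contrapT => nr; case/eqP: w0; elim/tens_ind: w => [//|y z -> ->|u v].
      exact: addr0.
    have [->|u0] := eqVneq v 0; first exact: tpure0r.
    by case: nr; exists v.
  have [zr zr0] := nzC _ _ yr0; have [zs zs0] := nzC _ _ ys0.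
  exists (tpure zr zs); apply: contra zr0 => /eqP e.
  by apply/eqP; apply: tpure_eq0 e zs0.
apply/lfunP => x; rewrite comp_lfunE [RHS]comp_lfunE.
apply: (elimT lker0P (tswap_ker0 _ _ _ _)).
rewrite tswap_prod_twist.
rewrite !(lfun_comp_eq (tswap_cpi_proj2_prod r s)).
rewrite (lfun_comp_eq (coev_insert_pow_join2 _ _ r s c2)).
rewrite -comp_lfunE tmap_comp hX ?hY; last by exists z.
- by rewrite -tmap_comp comp_lfunE.
by exists w.
Qed.

End Product.

(** * The unit objects *)

Section Unit.
Variables (k : fieldType) (A : cqs k).
Local Notation X := (comma_unit A).

(** Each tensor power of the line is spanned by [tone], and [cunit_proj] reads off the
    coefficient. *)
Lemma cunit_proj_ker0 n : lker (@cunit_proj k n) == 0%VS.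
Proof.
pose g := linfun (fun c : k^o => (c : k) *: tone k n).
have gE c : g c = (c : k) *: tone k n.
  by apply: linfunE => a x y; rewrite scalerDl scalerA.
apply: (@lfun_cancel_ker0 _ _ _ _ g); apply/lfunP => x.
rewrite comp_lfunE gE id_lfunE {g gE}.
elim: n x => [|n IH] x; first by rewrite /= id_lfunE; exact: mulr1.
elim/tpow_ind: x => [|x y hx hy|a x]; first by rewrite linear0 scale0r.
  by rewrite linearD scalerDl hx hy.
rewrite cunit_projS -[in RHS](IH x) tpureZr.
have -> : tpure a (tone k n) = (a : k) *: tone k n.+1.
  by rewrite -tpureZl; congr (tpure _ _); apply: esym; exact: mulr1.
by rewrite scalerA mulrC.
Qed.

Lemma cmap_unitE n a : cmap X n a = tpure (1 : k^o) a.
Proof. by apply: linfunE => c x y; rewrite tpurePr. Qed.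

Lemma cmap_gen_unit a : cmap_gen X a = tpure (1 : k^o) a.
Proof.
have I : lker (tmap (cgen (cunit k)) (cgen A)) == 0%VS.
  by rewrite tmap_ker0 ?(cgen_bij _).1.
apply: (elimT lker0P I); rewrite -(cmap_gen_cgen X) cmap_unitE tmap_pure.
congr (tpure _ _); rewrite cgenE [RHS]cunit_projS /= id_lfunE.
by apply: esym; exact: mulr1.
Qed.

Lemma cpi_unit beta a : cpi X (tpure beta a) = beta a.
Proof. rewrite cpi_pure cmap_gen_unit tcontr_pure; exact: mulr1. Qed.

Definition tpair (V : vectType k) n :
    'Hom(tens (tpow (dual V) n) (tpow V n), k^o) :=
  tlift (fun xi x => tdual V n xi x).

Lemma tpair_pure (V : vectType k) n xi x :
  tpair V n (tpure xi x) = tdual V n xi x.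
Proof.
rewrite /tpair tlift_pure //; split=> [y a u v|y a u v] /=.
  by rewrite linearP !lfun_simp.
by rewrite linearP.
Qed.

(** On generators [cpi] is evaluation, so in degree [n] it is the pairing of tensor powers. *)
Lemma cunit_proj_cpi n z :
  cunit_proj k n (tpmap (cpi X) n z) = tpair _ n (tshuf _ _ n z).
Proof.
elim: n z => [|n IH] z.
  rewrite tpmap0 tshuf0 -tpureZl tpair_pure tdual0 [LHS]id_lfunE.
  by rewrite [RHS]mulr1; apply: esym; exact: mulr1.
elim/tpow_ind: z => [|x y hx hy|w z]; first by rewrite !linear0.
  by rewrite !linearD /= hx hy.
rewrite tpmapS cunit_projS IH tshufS.
elim/tens_ind: w => [|x y hx hy|beta a].
- by rewrite tpure0l !linear0 scale0r.
- by rewrite tpureDl !linearD scalerDl /= hx hy.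
rewrite cpi_unit; elim/tens_ind: (tshuf _ _ n z) => [|x y hx hy|xi x].
- by rewrite tpure0r !linear0.
- by rewrite tpureDr !linearD /= hx hy.
by rewrite tswap_pure !tpair_pure tdualS.
Qed.

Lemma in_Omega_unit (a : cochain2 (gens A)) : is_Z2 a ->
  in_Omega X (join2 (join2 (dual_cochain a) a) (@id_cochain k _)).
Proof.
move=> aZ; have a2 : is_C2 a by case: aZ.
(* Under the injective [cunit_proj] both sides become the pairing, which [dual_cochainE]
   preserves. *)
have inv r s x : tpmap (cpi X) (r + s) (join2 (dual_cochain a) a r s x) =
    tpmap (cpi X) (r + s) x.
  apply: (elimT lker0P (cunit_proj_ker0 _)); rewrite !cunit_proj_cpi join2E.
  elim/tens_ind: (tshuf _ _ _ x) => [|y z hy hz|xi y].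
  - by rewrite !linear0.
  - by rewrite !linearD /= hy hz.
  by rewrite tmap_pure !tpair_pure dual_cochainE.
apply/in_Omega_join2P; first by apply: join2_Z2 => //; exact: dual_cochain_Z2.
split.
- by move=> r s x x0; rewrite inv.
- rewrite cmap_unitE cprod_cone; congr (tpure _ _).
  by rewrite /cone /= id_lfunE.
exists (fun r s => \1%VF); split.
  move=> r s x y; rewrite !cmap_unitE tswap_pure !tmap_pure !id_lfunE.
  congr (tpure _ _).
  (* The remaining identity is [e^r e^s = e^(r+s)]. *)
  have := @cmulE k (cunit k) r s (tone k r) (tone k s).
  rewrite [RHS]cunit_proj_tcat [cproj _ r _]cunit_proj_tone.
  rewrite [cproj _ s _]cunit_proj_tone => ->.
  by apply: esym; exact: mulr1.
move=> r s _; apply/lfunP => x.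
by rewrite comp_lfun1l [LHS]comp_lfunE 2![RHS]comp_lfunE inv.
Qed.

End Unit.

(** * Compatibility of the embedding with products and units *)

Lemma functor_irrelevance (C D : category) (fo : ob C -> ob D)
    (fm : forall x y, hom_of x y -> hom_of (fo x) (fo y)) i i' c c' :
  @Functor C D fo fm i c = @Functor C D fo fm i' c'.
Proof. by rewrite (Prop_irrelevance i i') (Prop_irrelevance c c'). Qed.

(** The third clause shows that the domain of the partial product contains all composable pairs over
    [C] whenever [C_n = 0] forces [B_n = 0]. *)
Theorem proposition1 (k : fieldType)
    (psi : forall A : cqs k, cochain2 (gens A))
    (hpsi : forall A : cqs k, is_Z2 (psi A)) :
  let omega := factorized psi in
  [/\ forall A C B : cqs k,
        functor_comp (P_Omega omega A B) (prod_Omega omega A C B) =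
        functor_comp (CA_prod k)
          (functor_comp (functor_prod (P_Omega omega A C) (P_Omega omega C B)) (functor_incl _)),
      forall A : cqs k, exists u : ob (Omega omega A A),
        sval u = comma_unit A /\ fob (P_Omega omega A A) u = cunit k
    & forall (A C B : cqs k) (X : ob (Omega omega A C)) (Y : ob (Omega omega C B)),
        (forall n, \dim {: piece C n} = 0%N -> \dim {: piece B n} = 0%N) ->
        in_Omega (comma_prod (sval X) (sval Y)) (omega A B)].
Proof.
move=> omega; have omegaE A B : omega A B =
    join2 (join2 (dual_cochain (psi B)) (psi A)) (@id_cochain k (gens B)).
  exact: join_cochainE.
split=> [A C B|A|A C B X Y dimCB].
(* Both composites have convertible object and arrow maps; only the proofs of the functor laws
   differ. *)
- exact: functor_irrelevance.
- have h : in_Omega (comma_unit A) (omega A A).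
    by rewrite omegaE; exact: in_Omega_unit.
  by exists (exist _ (comma_unit A) h).
rewrite (omegaE A B); apply: (in_Omega_prod (c := psi C)) => //.
  by rewrite -omegaE; exact: svalP X.
by rewrite -omegaE; exact: svalP Y.
Qed.
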